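(* Let $k$ be an algebraically closed field of characteristic zero, $F$ an algebraically closed extension of $k$ of transcendence degree $n$, $1\le n\le\infty$, $G=\mathrm{Aut}(F/k)$ with the topology described in the context, and let $G^{\circ}$ be the subgroup of $G$ generated by the compact subgroups of $G$. For any subgroup $H$ of $G$ containing $G^{\circ}$ and any continuous homomorphism $\pi$ from $H$, either $\pi$ is injective, or the restriction of $\pi$ to $G^{\circ}$ is trivial.
   Context: Topology on $G$: for a subfield $k\subseteq K\subseteq F$ put $U_K=\mathrm{Aut}(F/K)$; the subgroups $U_{k(x)}$, $x\in F$, generate the neighbourhoods of the identity (equivalently, the $U_L$ with $L$ finitely generated over $k$ form a base of neighbourhoods of the identity). $H$ has the induced topology. If $n=\infty$, the transcendence degree is countable. The target of $\pi$ is not specified in the statement; for linear representations, the paper's convention is that a representation is called continuous if the stabilizers of all vectors are closed. *)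

(* Defs.v *)
From HB Require Import structures.
From mathcomp Require Import all_boot all_order all_algebra.
From mathcomp Require Import all_classical all_reals all_analysis.
(* The notations of mpoly clash with those of MathComp-Analysis. *)
From mathcomp Require mpoly.
Import (canonicals, coercions) mpoly.

Set Implicit Arguments.
Unset Strict Implicit.
Unset Printing Implicit Defensive.

Import GRing.Theory.
Local Open Scope classical_set_scope.
Local Open Scope ring_scope.

Section FieldExtension.
Variables (k F : fieldType) (iota : {rmorphism k -> F}).

Definition intermediate_field (K : set F) : Prop :=
  GRing.divring_closed [in K] /\ range iota `<=` K.

(* k(S) *)
Definition adjoin (S : set F) : set F := smallest intermediate_field S.

Definition algebraic_over (K : set F) (x : F) : Prop :=
  exists p : {poly F}, [/\ p != 0, forall i, K p`_i & root p x].

Definition algebraically_independent (B : set F) : Prop :=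
  forall (m : nat) (b : 'I_m -> F), injective b -> (forall i, B (b i)) ->
  forall p : mpoly.mpoly m k, mpoly.mmap iota b p = 0 -> p = 0.

Definition transcendence_basis (B : set F) : Prop :=
  algebraically_independent B /\ forall x, algebraic_over (adjoin B) x.

(* [None] is the value oo, which means countably infinite. *)
Definition has_trdeg (n : option nat) : Prop :=
  exists2 B : set F, transcendence_basis B &
    (B #= if n is Some m then `I_m else [set: nat])%card.

Lemma adjoin_field S : intermediate_field (adjoin S).
Proof.
have E x : (x \in adjoin S) <-> adjoin S x by split=> [/set_mem|/mem_set].
split; last by move=> x kx K [[_ kK] _]; exact: kK.
split=> [|x y /E xS /E yS|x y /E xS /E yS]; apply/E => K KK;
  have [[[K1 KB KV] _] _] := KK.
- exact: set_mem.
- by apply: set_mem; apply: KB; apply: mem_set; [exact: xS|exact: yS].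
- by apply: set_mem; apply: KV; apply: mem_set; [exact: xS|exact: yS].
Qed.

Lemma sub_adjoin S : S `<=` adjoin S.
Proof. by move=> x Sx K [_]; exact. Qed.

Record autk := Autk {
  autk_fun :> {rmorphism F -> F};
  autk_bij : bijective autk_fun;
  autk_fix : forall a, autk_fun (iota a) = iota a }.

HB.instance Definition _ := gen_eqMixin autk.
HB.instance Definition _ := gen_choiceMixin autk.

Lemma autkP (g h : autk) : g =1 h -> g = h.
Proof.
case: g h => [g gb gf] [h hb hf] /= /funext gh.
have {gh} gh : g = h.
  case: g h gh {gb gf hb hf} => [g [[a] [b]]] [h [[a'] [b']]] /= gh; subst h.
  by rewrite (Prop_irrelevance a a') (Prop_irrelevance b b').
by subst h; rewrite (Prop_irrelevance gb hb) (Prop_irrelevance gf hf).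
Qed.

Lemma autk1_bij : bijective (idfun : {rmorphism F -> F}).
Proof. by exists id. Qed.

Definition autk1 : autk := Autk autk1_bij (fun=> erefl).

Lemma autkM_bij (g h : autk) : bijective (g \o h : {rmorphism F -> F}).
Proof. exact: bij_comp (autk_bij g) (autk_bij h). Qed.

Lemma autkM_fix (g h : autk) a :
  (g \o h : {rmorphism F -> F}) (iota a) = iota a.
Proof. by rewrite /= !autk_fix. Qed.

Definition autkM (g h : autk) : autk := Autk (autkM_bij g h) (autkM_fix g h).

Lemma autkV_subproof (g : autk) :
  {h : autk | cancel g h & cancel h g}.
Proof.
apply: cid2; have [h gK hK] := autk_bij g.
have hB : zmod_morphism h := can2_zmod_morphism gK hK.
have hM : monoid_morphism h := can2_monoid_morphism gK hK.
pose hBi := GRing.isZmodMorphism.Build F F h hB.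
pose hMi := GRing.isMonoidMorphism.Build F F h hM.
pose hR : {rmorphism F -> F} := HB.pack h hBi hMi.
have hb : bijective hR by exists g.
have hf a : hR (iota a) = iota a by rewrite -[RHS]gK autk_fix.
by exists (Autk hb hf).
Qed.

Definition autkV (g : autk) : autk := s2val (autkV_subproof g).

Lemma autkMA : associative autkM. Proof. by move=> f g h; exact: autkP. Qed.
Lemma autk1M : left_id autk1 autkM. Proof. by move=> g; exact: autkP. Qed.
Lemma autkM1 : right_id autk1 autkM. Proof. by move=> g; exact: autkP. Qed.
Lemma autkVM : left_inverse autk1 autkV autkM.
Proof.
by move=> g; apply: autkP => x; rewrite /= /autkV; case: autkV_subproof.
Qed.
Lemma autkMV : right_inverse autk1 autkV autkM.
Proof.
by move=> g; apply: autkP => x; rewrite /= /autkV; case: autkV_subproof.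
Qed.

HB.instance Definition _ := isGroup.Build autk autkMA autk1M autkM1 autkVM autkMV.

Lemma autkME (g h : autk) x : (g * h)%g x = g (h x). Proof. by []. Qed.
Lemma autk1E x : (1%g : autk) x = x. Proof. by []. Qed.

(* U_K = Aut(F/K) *)
Definition fixing (K : set F) : set autk := [set g | forall x, K x -> g x = x].

Lemma fixing_adjoin S : fixing (adjoin S) = fixing S.
Proof.
apply/seteqP; split=> g gS x; first by move/sub_adjoin; exact: gS.
pose K := [set x | g x = x]; apply: (_ : adjoin S `<=` K).
apply: smallest_sub => //; rewrite /intermediate_field.
have E y : (y \in K) <-> g y = y by split=> [/set_mem|/mem_set].
split; last by move=> _ [a _ <-] /=; exact: autk_fix.
split=> [|y z /E gy /E gz|y z /E gy /E gz]; apply/E.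
- exact: rmorph1.
- by rewrite rmorphB gy gz.
- by rewrite fmorph_div gy gz.
Qed.

Lemma fixing1 K : fixing K 1%g. Proof. by []. Qed.
Lemma fixingM K g h : fixing K g -> fixing K h -> fixing K (g * h)%g.
Proof. by move=> gK hK x Kx; rewrite autkME hK ?gK. Qed.
Lemma fixingV K g : fixing K g -> fixing K g^-1%g.
Proof. by move=> gK x Kx; rewrite -{1}(gK x Kx) -autkME mulVg. Qed.

(* The left translates g U_L, for L finitely generated over k, form a base of
   neighbourhoods of g. *)
Definition autk_nbhs (g : autk) : set_system autk :=
  filter_from (@finite_set F)
    (fun S => [set (g * u)%g | u in fixing (adjoin S)]).

HB.instance Definition _ := hasNbhs.Build autk autk_nbhs.

Lemma autk_nbhs_filter (g : autk) : ProperFilter (nbhs g).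
Proof.
apply: filter_from_proper; last first.
  by move=> S _; exists g; exists 1%g; [exact: fixing1|rewrite mulg1].
apply: filter_from_filter; first by exists set0.
move=> S T Sf Tf; exists (S `|` T); first by rewrite finite_setU.
rewrite !fixing_adjoin => _ [u uST <-].
by split; exists u => // x ?; apply: uST; [left|right].
Qed.

Lemma autk_nbhs_singleton (g : autk) A : nbhs g A -> A g.
Proof.
by case=> S _; apply; exists 1%g; [exact: fixing1|rewrite mulg1].
Qed.

Lemma autk_nbhs_nbhs (g : autk) (A : set autk) :
  nbhs g A -> nbhs g (nbhs^~ A).
Proof.
case=> S Sf gSA; exists S => // _ [u uS <-]; exists S => // _ [v vS <-].
by apply: gSA; exists (u * v)%g; [exact: fixingM|rewrite mulgA].
Qed.

HB.instance Definition _ := Nbhs_isNbhsTopological.Build autk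
  autk_nbhs_filter autk_nbhs_singleton autk_nbhs_nbhs.

End FieldExtension.

HB.mixin Record isTopologicalGroup T & Topological T & Group T := {
  mulg_continuous : continuous (fun xy : T * T => (xy.1 * xy.2)%g);
  invg_continuous : continuous (fun x : T => x^-1%g) }.

#[short(type="topologicalGroupType")]
HB.structure Definition TopologicalGroup :=
  {T of Topological T & Group T & isTopologicalGroup T}.

Section AutkTopologicalGroup.
Variables (k F : fieldType) (iota : {rmorphism k -> F}).
Local Notation G := (autk iota).

Lemma autk_mulg_continuous : continuous (fun xy : G * G => (xy.1 * xy.2)%g).
Proof.
move=> [g h] A [S Sf ghSA].
exists ([set (g * u)%g | u in fixing (adjoin iota (h @` S))],
        [set (h * u)%g | u in fixing (adjoin iota S)]) => /=.
  by split; [exists (h @` S) => //; exact: finite_image|exists S].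
rewrite !fixing_adjoin => -[_ _] /= [[u uS <-] [v vS <-]].
apply: ghSA; rewrite fixing_adjoin.
exists (h^-1 * u * h * v)%g; last by rewrite !mulgA mulgK.
apply: fixingM => // x Sx; rewrite !autkME uS; last by exists x.
by rewrite -autkME mulVg.
Qed.

Lemma autk_invg_continuous : continuous (fun x : G => x^-1%g).
Proof.
move=> g A [S Sf gSA]; exists ((g^-1%g : G) @` S); first exact: finite_image.
rewrite fixing_adjoin => _ [u uS <-] /=; apply: gSA; rewrite fixing_adjoin.
exists (g * u^-1 * g^-1)%g; last by rewrite !mulgA mulVg mul1g invgM.
move=> x Sx; rewrite !autkME (fixingV uS); last by exists x.
by rewrite -autkME mulgV.
Qed.

HB.instance Definition _ :=
  isTopologicalGroup.Build G autk_mulg_continuous autk_invg_continuous.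

End AutkTopologicalGroup.

Definition subgroup (gT : groupType) (A : set gT) : Prop := group_closed [in A].

Definition generated (gT : groupType) (A : set gT) : set gT :=
  smallest (@subgroup gT) A.

Definition Gcirc (G : topologicalGroupType) : set G :=
  generated (\bigcup_(C in [set C : set G | subgroup C /\ compact C]) C).
Arguments Gcirc : clear implicits.

(* Linear representations of the subgroup H, as functions on the whole of G
   whose values outside H are irrelevant. *)
Definition representation (gT : groupType) (H : set gT)
    (E : fieldType) (W : lmodType E) (rho : gT -> {linear W -> W}) : Prop :=
  rho 1%g =1 id /\
  {in H &, forall g h, rho (g * h)%g =1 rho g \o rho h}.

Definition continuous_representation (G : topologicalGroupType) (H : set G)
    (E : fieldType) (W : lmodType E) (rho : G -> {linear W -> W}) : Prop :=
  representation H rho /\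
  forall w : W, closed ([set g | H g /\ rho g w = w] : set (subspace H)).

(* Main.v *)
Require Import Defs.
From HB Require Import structures.
From mathcomp Require Import all_boot all_order all_algebra all_field.
From mathcomp Require Import finmap ring.
From mathcomp Require Import all_classical all_reals all_analysis.

Set Implicit Arguments.
Unset Strict Implicit.
Unset Printing Implicit Defensive.

Import GRing.Theory.
Local Open Scope classical_set_scope.
Local Open Scope ring_scope.

(* Let [N] be the kernel, a closed normal subgroup of [H], and suppose [N <> 1].
   For [g] in [N] and [u] in a small [U_L], the commutator [[g, u]] lies in [N]
   and fixes [k(Z)] for a prescribed finite independent set [Z].  Taking roots of
   [t - c] with [t] in [Z] moved by [g], and using that a finitely generated field
   has no divisible elements outside [k], one finds [[g, u]] that multiplies some
   [z], [z ^ m = t - c], by a root of unity [<> 1].  Its commutator with a lift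
   of a translation [z -> z + b] is an element of [N] that translates [z] and fixes
   the algebraic closure of [k(Z \ t)].

   The geometric input is that a finite extension [M] of [k'(x)], [k'] algebraically
   closed of characteristic 0, is trivial if a lift of [x -> x + 1] preserves it
   (the affine line is simply connected).  Elementarily: for [a] in [M] integral
   over [k'[x]], traces show that the translates of [a] span a finite-dimensional
   [k']-space, and an eigenvector of the translation is constant, so that [a] is a
   polynomial in [x].

   Applied to the fixed field of [N] meet [U_k(Y)], first with translations in [N],
   then, for any other finite independent [Y], with translations in [Gcirc], this
   shows that this fixed field is [k(Y)].  As the elements of a compact subgroup
   have finite orbits, each of them agrees on any finite set with an element of
   [N]; since [N] is closed, it contains all compact subgroups. *)

(** * Polynomials and the translation X -> X + 1 *)

(** The difficulty is that [N] is known through a single element [g] whose action is not explicit. A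
    commutator trivial on [Z] can only be seen outside [k(Z)]; hence the radicals [z], on which [u]
    acts by roots of unity, which are constants. The shift by [c] is there because [g] may itself
    multiply [t] by a constant.

    The bases whose translations lie in [N] therefore depend on [g], whereas an element of a compact
    subgroup is only known to fix a finite set that depends on that element. For a basis [Y] adapted
    to the latter, translations are available only in [Gcirc], as products of two reflections. They
    normalize [N] and preserve [k(Y)], hence preserve the fixed field; but the geometric input also
    requires that field to be finite over [k(Y)]. This is what the first basis [Y1] provides:
    density of [N] over [k(Y1)] forces the fixed field into [k(Y, Y1)].

    The geometric input has one variable and algebraically closed constants, while the conclusion is
    about [k(Y)]. The variables are thus eliminated one at a time, the algebraic closure of
    [k(Y \ y)] serving as constants for [y]. *)

Lemma pcharf0_natf_neq0 (K : fieldType) (n : nat) :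
  [pchar K] =i pred0 -> (n.+1%:R : K) != 0.
Proof. by move=> c0; rewrite ((pcharf0P _).1 c0). Qed.

Lemma pchar0_rmorph (K L : fieldType) (j : {rmorphism K -> L}) :
  [pchar L] =i pred0 <-> [pchar K] =i pred0.
Proof. by split=> H p; rewrite -(H p) (fmorph_pchar j). Qed.

Section Shift.
Variable (K : fieldType).
Hypothesis char0 : [pchar K] =i pred0.
Implicit Types p q : {poly K}.
Local Notation sh := (comp_poly ('X + 1%:P)) (only parsing).

Lemma size_shift p : size (sh p) = size p.
Proof. by rewrite size_comp_poly2 // size_XaddC. Qed.

Lemma lead_coef_shift p : lead_coef (sh p) = lead_coef p.
Proof.
by rewrite lead_coef_comp ?size_XaddC // lead_coefXaddC expr1n mulr1.
Qed.

(** Only the two top terms of the binomial expansion matter; the second coefficient is nonzero in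
    characteristic 0. *)
Lemma shift_Xn_subdef n :
  exists2 q : {poly K}, sh ('X^(n.+1)) = 'X^(n.+1) + n.+1%:R *: 'X^n + q & (size q <= n)%N.
Proof.
elim: n => [|n [q E sq]].
  by exists 0; rewrite ?size_poly0 // !expr1 expr0 comp_polyX scale1r addr0.
exists (n.+1%:R *: 'X^n + q * ('X + 1%:P)).
  rewrite exprS comp_polyM E comp_polyX [n.+2%:R]mulrSr -!mul_polyC polyCD.
  rewrite polyC1 !exprS; ring.
rewrite (leq_trans (size_polyD _ _)) // geq_max (leq_trans (size_scale_leq _ _)) ?size_polyXn //=.
rewrite (leq_trans (size_polyMleq _ _)) // size_XaddC addn2 /= ltnS //.
Qed.

(* Comparing the two leading coefficients forces [mu = 1] and degree 0. *)
Lemma shift_eigen p (mu : K) : sh p = mu *: p -> (size p <= 1)%N.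
Proof.
move=> E; rewrite leqNgt; apply/negP => sp.
have p0 : p != 0 by rewrite -size_poly_gt0 (leq_trans _ sp).
have lp0 : lead_coef p != 0 by rewrite lead_coef_eq0.
have mu1 : mu = 1.
  have := lead_coef_shift p; rewrite E lead_coefZ => /(canRL (mulfK lp0)).
  by rewrite mulfV.
rewrite mu1 scale1r in E.
have [n en] : exists n, size p = n.+2 by exists (size p).-2; case: (size p) sp => [|[]].
pose q := p - lead_coef p *: 'X^(n.+1).
have sq : (size q <= n.+1)%N.
  apply/leq_sizeP => i; rewrite leq_eqVlt => /predU1P[<-|lni].
    by rewrite coefB coefZ coefXn eqxx mulr1 /lead_coef en subrr.
  rewrite coefB coefZ coefXn (gtn_eqF lni) mulr0 subr0 nth_default // en //.
have ep : p = lead_coef p *: 'X^(n.+1) + q by rewrite addrC subrK.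
have [r Er sr] := shift_Xn_subdef n.
have shq : (sh q)`_n = q`_n.
  have [sqn|sqn] := leqP (size q) n; first by rewrite !nth_default ?size_shift.
  have e : size q = n.+1 by apply/eqP; rewrite eqn_leq sq.
  by have := lead_coef_shift q; rewrite /lead_coef size_shift e.
have : (lead_coef p *: sh ('X^(n.+1)) + sh q)`_n = (lead_coef p *: 'X^(n.+1) + q)`_n.
  by rewrite -comp_polyZ -comp_polyD -ep E.
rewrite Er coefD [RHS]coefD shq => /addIr; rewrite !coefZ => /(mulfI lp0).
rewrite !coefD -[RHS]addr0 -addrA => /addrI.
rewrite coefZ coefXn eqxx mulr1 nth_default // addr0.
by apply/eqP/pcharf0_natf_neq0.
Qed.

(** The leading term of [p] can always be cancelled: [sh - mu] multiplies leading coefficients by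
    [1 - mu], and for [mu = 1] it lowers the degree by one, the new leading coefficient being
    multiplied by the old degree, which is invertible in characteristic 0. *)
Lemma shift_sub_surj (mu : K) p : exists q, sh q - mu *: q = p.
Proof.
have [n] := ubnP (size p); elim: n p => // n IHn p; rewrite ltnS => spn.
have [->|p0] := eqVneq p 0.
  by exists 0; rewrite comp_poly0 scaler0 subr0.
suff [q0 sq0] : exists q0, (size (p - (sh q0 - mu *: q0))%R < size p)%N.
  have [|q Eq] := IHn (p - (sh q0 - mu *: q0)); first by apply: leq_trans spn.
  exists (q + q0); rewrite comp_polyD scalerDr opprD addrACA Eq subrK //.
have [m em] : exists m, size p = m.+1.
  by exists (size p).-1; rewrite prednK // size_poly_gt0.
have red q1 : (size q1 <= m.+1)%N -> q1`_m = lead_coef p ->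
    (size (p - q1)%R < m.+1)%N.
  move=> sq1 lq1; rewrite ltnS; apply/leq_sizeP => i.
  rewrite leq_eqVlt => /predU1P[<-|lmi]; first by rewrite coefB lq1 /lead_coef em subrr.
  by rewrite coefB !nth_default ?subrr ?em // (leq_trans sq1).
rewrite em; have [mu1|mu1] := eqVneq mu 1.
  have [r Er sr] := shift_Xn_subdef m.
  exists ((lead_coef p / m.+1%:R) *: 'X^(m.+1)).
  have m0 : (m.+1%:R : K) != 0 by apply: pcharf0_natf_neq0.
  rewrite mu1 scale1r comp_polyZ Er -scalerBr.
  rewrite [X in _ *: X]addrC -[X in _ *: (_ + X)]addrA addKr.
  apply: red.
    rewrite (leq_trans (size_scale_leq _ _)) // (leq_trans (size_polyD _ _)) //.
    rewrite geq_max (leq_trans (size_scale_leq _ _)) ?size_polyXn //=.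
    exact: leqW.
  by rewrite coefZ coefD coefZ coefXn eqxx mulr1 [r`_m]nth_default // addr0 divfK.
have mu1' : 1 - mu != 0 by rewrite subr_eq0 eq_sym.
exists ((lead_coef p / (1 - mu)) *: 'X^m).
have sX : size (sh ('X^m : {poly K})) = m.+1 by rewrite size_shift size_polyXn.
have lX : (sh ('X^m : {poly K}))`_m = 1.
  by have := lead_coef_shift ('X^m); rewrite lead_coefXn /lead_coef sX.
apply: red.
  rewrite comp_polyZ (leq_trans (size_polyD _ _)) // geq_max size_polyN.
  rewrite !(leq_trans (size_scale_leq _ _)) ?sX ?size_polyXn //.
rewrite comp_polyZ coefB !coefZ lX coefXn eqxx !mulr1.
by rewrite -{1}[_ / _]mul1r -mulrBl mulrC divfK.
Qed.

End Shift.

Section EvalX.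
Variables (K F : fieldType) (j : {rmorphism K -> F}) (x : F).

Definition evalX : {rmorphism {poly K} -> F} :=
  horner_morph (fun a => mulrC x (j a)).

Lemma evalXE p : evalX p = (map_poly j p).[x]. Proof. by []. Qed.
Lemma evalXC a : evalX a%:P = j a. Proof. by rewrite evalXE map_polyC hornerC. Qed.
Lemma evalX_X : evalX 'X = x. Proof. by rewrite evalXE map_polyX hornerX. Qed.

Hypothesis xtr : ~ algebraicOver j x.

Lemma evalX_eq0 p : (evalX p == 0) = (p == 0).
Proof.
apply/idP/eqP => [px0|->]; last by rewrite rmorph0.
by apply/eqP; apply: contraT => p0; case: xtr; exists p.
Qed.

End EvalX.
Arguments evalX : simpl never.

Lemma horner_map_wide (R : nzRingType) (S : comNzRingType) (f : {rmorphism R -> S}) n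
    (A : {poly R}) y :
  (size A <= n)%N -> (map_poly f A).[y] = \sum_(i < n) f A`_i * y ^+ i.
Proof.
move=> sA; rewrite (@horner_coef_wide _ n) ?(leq_trans (size_poly _ _)) //.
by apply: eq_bigr => i _; rewrite coef_map.
Qed.

(** * Algebraic functions of [x] that are eigenvectors of a translation *)

Section Translation.
Variables (K F : fieldType) (j : {rmorphism K -> F}) (x : F).
Variable h : {rmorphism F -> F}.
Hypothesis char0 : [pchar K] =i pred0.
Hypothesis Kclosed : forall a, algebraicOver j a -> exists b, a = j b.
Hypothesis hj : forall a, h (j a) = j a.
Hypothesis hx : h x = x + 1.
Local Notation ev := (evalX j x).
Local Notation sh := (comp_poly ('X + 1%:P)) (only parsing).

(** Algebraicity over [K(x)], with coefficients in [K[X]] rather than in fractions: degrees in [x]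
    can then be compared, and [h] acts on the coefficients through [sh]. *)
Definition algX y := exists2 A : {poly {poly K}}, A != 0 & root (map_poly ev A) y.

Lemma evalX_shift p : ev (sh p) = h (ev p).
Proof.
rewrite !evalXE map_comp_poly horner_comp rmorphD /= map_polyX map_polyC /=.
rewrite rmorph1 hornerD hornerX hornerC -hx -horner_map -map_poly_comp.
by congr (_.[_]); apply: eq_map_poly => a /=; rewrite hj.
Qed.

(* The relation [A(x, g) = 0] of least degree in [g], then of least leading
   coefficient, is semi-invariant under [h], hence has constant coefficients. *)
Lemma translation_eigen g (lam : K) : lam != 0 -> algX g -> h g = j lam * g ->
  exists b, g = j b.
Proof.
move=> lam0 [A A0 Ag] hg; apply: Kclosed; move: A0 Ag.
have [n] := ubnP (size A); elim: n A => // n IHn A; rewrite ltnS.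
have [m] := ubnP (size (lead_coef A)); elim: m A => // m IHm A; rewrite ltnS.
move=> sl sA A0 /rootP Ag.
have [e eA] : exists e, size A = e.+1 by exists (size A).-1; rewrite prednK // size_poly_gt0.
(* The value of [Ah] at [g] is the image under [h] of the value of [A] at [g]. In [B] the
   coefficient of index [e] is a multiple of the difference between the leading coefficient of [A]
   and its translate, which has smaller degree. *)
pose Ah : {poly {poly K}} := \poly_(i < e.+1) (lam ^+ i *: sh A`_i).
pose B : {poly {poly K}} := (lam ^+ e)%:P *: A - Ah.
have Bg : root (map_poly ev B) g.
  have Ahg : (map_poly ev Ah).[g] = h (map_poly ev A).[g].
    rewrite !(@horner_map_wide _ _ _ e.+1) ?size_poly ?eA // rmorph_sum.
    apply: eq_bigr => i _; rewrite coef_poly ltn_ord rmorphM rmorphXn /= hg.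
    by rewrite -mul_polyC rmorphM /= evalXC rmorphXn evalX_shift exprMn mulrCA mulrA.
  apply/rootP; rewrite rmorphB /= hornerD hornerN Ahg map_polyZ /= hornerZ.
  by rewrite Ag rmorph0 mulr0 subrr.
have sB : (size B <= e.+1)%N.
  rewrite (leq_trans (size_polyD _ _)) // size_polyN geq_max size_poly andbT.
  by rewrite (leq_trans (size_scale_leq _ _)) ?eA.
have coefB_ i : (i < e.+1)%N -> B`_i = lam ^+ e *: A`_i - lam ^+ i *: sh A`_i.
  by move=> lie; rewrite coefB coefZ coef_poly lie mul_polyC.
have Be : (size (B`_e)%R < size (lead_coef A))%N.
  have lA : lead_coef A = A`_e by rewrite /lead_coef eA.
  have l0 : lead_coef A != 0 by rewrite lead_coef_eq0.
  rewrite coefB_ // -scalerBr (leq_ltn_trans (size_scale_leq _ _)) // -lA.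
  set p := lead_coef A in l0 *.
  have -> : size p = (size p).-1.+1 by rewrite prednK // size_poly_gt0.
  rewrite ltnS; apply/leq_sizeP => i; rewrite leq_eqVlt => /predU1P[<-|li].
    have := lead_coef_shift p; rewrite /lead_coef size_shift => E.
    by rewrite coefB E subrr.
  have sp : (size p <= i)%N by rewrite -(prednK (n := size p)) // size_poly_gt0.
  by rewrite coefB !nth_default ?subrr // size_shift.
have [B0|B0] := eqVneq B 0.
  have A_const i : exists a, A`_i = a%:P.
    have [lie|lie] := ltnP i e.+1; last by exists 0; rewrite nth_default ?eA.
    have := coefB_ i lie; rewrite B0 coef0 => /esym/eqP; rewrite subr_eq0 => /eqP E.
    have l0 : lam ^+ i != 0 by rewrite expf_neq0.
    exists (A`_i)`_0; apply: size1_polyC; apply: (@shift_eigen _ char0 _ (lam ^+ e / lam ^+ i)).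
    by rewrite mulrC -scalerA E scalerA mulVf // scale1r.
  exists (\poly_(i < e.+1) (A`_i)`_0).
    have [a Ea] := A_const e; apply: contraNneq A0 => /(congr1 (fun p : {poly K} => p`_e)).
    rewrite coef_poly ltnSn coef0 -lead_coef_eq0 /lead_coef eA Ea coefC /= => ->.
    by rewrite polyC0.
  apply/rootP; rewrite -[RHS]Ag !(@horner_map_wide _ _ _ e.+1) ?size_poly ?eA //.
  apply: eq_bigr => i _; rewrite coef_poly ltn_ord; have [a ->] := A_const i.
  by rewrite coefC /= evalXC.
have [se|se] := leqP (size B) e.
  by apply: (IHn B); rewrite // (leq_ltn_trans se) // -ltnS -eA ltnS.
have eB : size B = e.+1 by apply/eqP; rewrite eqn_leq sB.
apply: (IHm B) => //; last by rewrite eB -eA.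
by rewrite /lead_coef eB (leq_trans Be).
Qed.

Lemma algX_sub y z : algX y -> algX (y - ev z).
Proof.
move=> [A A0 Ay]; exists (A \Po ('X + z%:P)).
  by rewrite -size_poly_eq0 size_comp_poly2 ?size_XaddC ?size_poly_eq0.
rewrite rootE map_comp_poly horner_comp rmorphD /= map_polyX map_polyC /=.
by rewrite hornerD hornerX hornerC subrK.
Qed.

(** A polynomial solution of the same equation, given by [shift_sub_surj], is subtracted to make the
    equation homogeneous. For [lam = 0] injectivity of [h] concludes, since [translation_eigen] asks
    for a nonzero eigenvalue. *)
Lemma translation_affine_eigen g lam p : algX g -> h g - j lam * g = ev p ->
  exists q, g = ev q.
Proof.
move=> ag E; have [q Eq] := shift_sub_surj char0 lam p.
have Eh : h (g - ev q) = j lam * (g - ev q).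
  apply/eqP; rewrite -subr_eq0 rmorphB /=.
  have -> : h g - h (ev q) - j lam * (g - ev q) =
      h g - j lam * g - (h (ev q) - j lam * ev q) by ring.
  by rewrite E -Eq rmorphB /= -mul_polyC rmorphM /= evalXC evalX_shift subrr.
have [l0|l0] := eqVneq lam 0.
  exists q; apply/eqP; rewrite -subr_eq0 -(fmorph_eq0 h) Eh l0 rmorph0 mul0r.
  exact: eqxx.
have [b Eb] := translation_eigen l0 (algX_sub q ag) Eh.
by exists (q + b%:P); rewrite rmorphD /= evalXC -Eb addrC subrK.
Qed.

End Translation.

(** * Integrality over k[x] and at infinity *)

Section IntegralEval.
Variables (K F : fieldType) (j : {rmorphism K -> F}) (x : F).
Hypothesis xtr : ~ algebraicOver j x.
Local Notation ev := (evalX j x).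

Lemma integral_scale (A : {poly {poly K}}) y : A != 0 -> root (map_poly ev A) y ->
  exists2 c, c != 0 & integralOver ev (ev c * y).
Proof.
move=> A0 /rootP Ay; have c0 : lead_coef A != 0 by rewrite lead_coef_eq0.
exists (lead_coef A) => //; set c := lead_coef A in c0 *.
have [e eA] : exists e, size A = e.+1 by exists (size A).-1; rewrite prednK // size_poly_gt0.
have cA : c = A`_e by rewrite /c /lead_coef eA.
case: e => [|e] in eA cA *.
  move: Ay; rewrite (@horner_map_wide _ _ _ 1) ?eA // big_ord1 expr0 mulr1 -cA.
  by move/eqP; rewrite evalX_eq0 // (negPf c0).
pose q := \poly_(i < e.+1) (A`_i * c ^+ (e - i)).
have sq : (size q < size ('X^(e.+1) : {poly {poly K}}))%N.
  by rewrite size_polyXn ltnS size_poly.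
exists ('X^(e.+1) + q).
  by rewrite monicE lead_coefDl // lead_coefXn.
apply/rootP; rewrite rmorphD /= map_polyXn hornerD hornerXn.
rewrite (@horner_map_wide _ _ _ e.+1) ?size_poly //.
transitivity (ev c ^+ e * (map_poly ev A).[y]); last by rewrite Ay mulr0.
rewrite (@horner_map_wide _ _ _ e.+2) ?eA //.
rewrite [in RHS]big_ord_recr /= -cA mulrDr mulr_sumr [LHS]addrC; congr (_ + _); last first.
  by rewrite exprMn exprSr -!mulrA.
apply: eq_bigr => i _; rewrite coef_poly ltn_ord rmorphM rmorphXn /= exprMn.
have -> : ev c ^+ e = ev c ^+ (e - i) * ev c ^+ i by rewrite -exprD subnK // -ltnS.
ring.
Qed.

(** [K[x]] is integrally closed: once the fraction is reduced, its denominator divides a power of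
    its numerator and so is constant. *)
Lemma integral_frac p q : ev q != 0 -> integralOver ev (ev p / ev q) ->
  exists c, ev p / ev q = ev c.
Proof.
move=> q0 [Q mQ /rootP Qr]; pose g := gcdp p q.
have q0' : q != 0 by rewrite -(evalX_eq0 xtr).
have g0 : g != 0 by rewrite gcdp_eq0 negb_and q0' orbT.
have := coprimep_div_gcd (p := p) (q := q); rewrite q0' orbT => /(_ isT).
rewrite -/g; set p' := p %/ g; set q' := q %/ g => cpq.
have Ep : p = p' * g by rewrite divpK // dvdp_gcdl.
have Eq : q = q' * g by rewrite divpK // dvdp_gcdr.
have gq : ev g != 0 by rewrite evalX_eq0.
have q'0 : ev q' != 0 by move: q0; rewrite Eq rmorphM mulf_eq0 negb_or => /andP[].
have Epq : ev p / ev q = ev p' / ev q'.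
  by rewrite Ep Eq !rmorphM /= -mulf_div mulfV // mulr1.
move: Qr; rewrite Epq.
have [e eQ] : exists e, size Q = e.+1.
  by exists (size Q).-1; rewrite prednK // size_poly_gt0 monic_neq0.
rewrite (@horner_map_wide _ _ _ e.+1) ?eQ // => Qr.
pose s := \sum_(i < e) Q`_i * p' ^+ i * q' ^+ (e - i.+1).
have Es : p' ^+ e = - s * q'.
  apply/eqP; rewrite -subr_eq0 mulNr opprK -(evalX_eq0 xtr).
  suff -> : ev (p' ^+ e + s * q') = ev q' ^+ e * (\sum_(i < e.+1) ev Q`_i * (ev p' / ev q') ^+ i).
    by rewrite Qr mulr0.
  rewrite big_ord_recr /= mulrDr addrC rmorphD /=; congr (_ + _).
    rewrite mulr_suml !rmorph_sum mulr_sumr; apply: eq_bigr => i _.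
    rewrite !rmorphM !rmorphXn /= expr_div_n.
    have -> : ev q' ^+ e = ev q' ^+ (e - i.+1) * ev q' * ev q' ^+ i.
      by rewrite -!exprSr -exprD addSn -addnS subnK.
    by field; rewrite expf_neq0.
  rewrite rmorphXn /=; have -> : Q`_e = 1 by move/monicP: mQ; rewrite /lead_coef eQ.
  by rewrite rmorph1 mul1r expr_div_n mulrC divfK // expf_neq0.
have /eqP sq : size q' == 1.
  have : q' %| p' ^+ e by rewrite Es dvdp_mull.
  rewrite -[_ ^+ e]mul1r Gauss_dvdpl ?dvdp1 //.
  by rewrite coprimep_expr // coprimep_sym.
have [c c0 Ec] : exists2 c, c != 0 & q' = c%:P.
  exists q'`_0; last by apply: size1_polyC; rewrite sq.
  apply/eqP => c0; have := size1_polyC (eq_leq sq); rewrite c0 polyC0 => e0.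
  by move: sq; rewrite e0 size_poly0.
exists (c^-1 *: p'); rewrite Ec evalXC -mul_polyC rmorphM /= evalXC fmorphV mulrC //.
Qed.
End IntegralEval.

Section IntegralInfinity.
Variables (K F : fieldType) (j : {rmorphism K -> F}) (x : F).
Hypothesis xtr : ~ algebraicOver j x.
Local Notation ev := (evalX j x).
Local Notation evV := (evalX j x^-1).

Lemma transcendental_neq0 : x != 0.
Proof. by apply/eqP => x0; apply: xtr; rewrite x0; apply: algebraic0. Qed.
Let x0 := transcendental_neq0.

Lemma transcendental_inv : ~ algebraicOver j x^-1.
Proof. by move/algebraic_inv; rewrite invrK. Qed.

Lemma evalX_rev (p : {poly K}) m : (size p <= m.+1)%N ->
  ev p / x ^+ m = evV (\poly_(l < m.+1) p`_(m - l)).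
Proof.
move=> sp; rewrite !evalXE !(@horner_map_wide _ _ _ m.+1) ?size_poly //.
rewrite (reindex_inj rev_ord_inj) mulr_suml; apply: eq_bigr => l _ /=.
rewrite coef_poly ltn_ord subSS -mulrA; congr (_ * _).
have lm : (l <= m)%N by rewrite -ltnS.
have -> : x ^+ m = x ^+ (m - l) * x ^+ l by rewrite -exprD subnK.
by rewrite invfM mulrA mulfV ?expf_neq0 // mul1r exprVn.
Qed.

(** Dividing the relation of degree [e] by [x ^+ (r * e)] turns its coefficient of index [i] into
    one divided by [x ^+ (r * (e - i))]. For [i < e] its degree is at most [r], hence at most
    [r * (e - i)], and the quotient is a polynomial in [x^-1]. *)
Lemma integral_infinity (Q : {poly {poly K}}) r y : Q \is monic ->
    (forall i, (size (Q`_i)%R <= r.+1)%N) -> root (map_poly ev Q) y ->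
  integralOver evV (y / x ^+ r).
Proof.
move=> mQ sQ /rootP Qy.
have [e eQ] : exists e, size Q = e.+1.
  by exists (size Q).-1; rewrite prednK // size_poly_gt0 monic_neq0.
have Qe : Q`_e = 1 by move/monicP: mQ; rewrite /lead_coef eQ.
pose P := 'X^e + \poly_(i < e) (ev Q`_i / x ^+ (r * (e - i))).
have sP : (size (\poly_(i < e) (ev Q`_i / x ^+ (r * (e - i))))%R < size ('X^e : {poly F}))%N.
  by rewrite size_polyXn ltnS size_poly.
have mP : P \is monic by rewrite monicE lead_coefDl // lead_coefXn.
apply: (integral_root_monic mP).
  apply/rootP; rewrite hornerD hornerXn horner_poly.
  have xr0 : x ^+ r != 0 by rewrite expf_neq0.
  transitivity ((map_poly ev Q).[y] / (x ^+ r) ^+ e); last by rewrite Qy mul0r.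
  rewrite (@horner_map_wide _ _ _ e.+1) ?eQ // big_ord_recr /= Qe rmorph1 mul1r.
  rewrite mulrDl addrC mulr_suml expr_div_n; congr (_ + _); apply: eq_bigr => i _.
  have -> : (x ^+ r) ^+ e = (x ^+ r) ^+ (e - i) * (x ^+ r) ^+ i.
    by rewrite -exprD subnK // ltnW.
  rewrite exprM expr_div_n; move: (x ^+ r) xr0 => w w0.
  by field; rewrite ?expf_neq0 ?x0.
apply/integral_poly => i; rewrite coefD coefXn coef_poly.
apply: integral_add; first exact: integral_nat.
case: ltnP => [lie|_]; last exact: mxpoly.integral0.
rewrite evalX_rev; first exact: integral_id.
rewrite (leq_trans (sQ i)) // ltnS -{1}[r]muln1 leq_mul2l subn_gt0 lie orbT //.
Qed.

(** Sections of O(N) on the projective line: integrality over [K[x]] excludes finite poles, and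
    integrality of [y / x ^+ N] over [K[x^-1]] bounds the pole at infinity. The degree is read off
    after writing both polynomials in the variable [x]. *)
Lemma frac_integral_size y N : (exists p q, ev q != 0 /\ y = ev p / ev q) ->
    integralOver ev y -> integralOver evV (y / x ^+ N) ->
  exists2 c : {poly K}, (size c <= N.+1)%N & y = ev c.
Proof.
move=> [p [q [q0 Ey]]] iy iyV; rewrite Ey in iy iyV *.
have [c Ec] := integral_frac xtr q0 iy; rewrite Ec in iyV *; exists c => //.
pose m := size c; have sc : (size c <= m.+1)%N by [].
have Ec' : ev c / x ^+ N = evV (\poly_(l < m.+1) c`_(m - l) * 'X^N) / evV 'X^m.
  rewrite rmorphM !rmorphXn /= evalX_X -evalX_rev // !exprVn.
  by field; rewrite !expf_neq0 // oner_neq0.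
have V0 : evV 'X^m != 0 by rewrite rmorphXn /= evalX_X expf_neq0 // invr_eq0.
move: iyV; rewrite Ec' => iyV.
have [e Ee] := integral_frac transcendental_inv V0 iyV; rewrite -Ec' in Ee.
pose M := size e; have se : (size e <= M.+1)%N by [].
have x0' : x^-1 != 0 by rewrite invr_eq0.
have Ee' : evV e = ev (\poly_(l < M.+1) e`_(M - l)) / x ^+ M.
  have xinv : ev (\poly_(l < M.+1) e`_(M - l)) / x ^+ M =
      evV (\poly_(l < M.+1) (\poly_(l < M.+1) e`_(M - l))`_(M - l)).
    by rewrite evalX_rev // size_poly.
  rewrite xinv; congr (evV _); apply/polyP => i; rewrite coef_poly ltnS.
  case: leqP => [iM|Mi]; last by rewrite nth_default // ltnW.
  by rewrite coef_poly ltnS leq_subr subKn.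
have /eqP : ev (c * 'X^M) = ev ('X^N * \poly_(l < M.+1) e`_(M - l)).
  rewrite !rmorphM !rmorphXn /= evalX_X.
  have -> : ev c = evV e * x ^+ N by rewrite -Ee divfK // expf_neq0.
  by rewrite Ee'; field; rewrite expf_neq0.
rewrite -subr_eq0 -rmorphB evalX_eq0 // subr_eq0 => /eqP E.
have [->|c0] := eqVneq c 0; first by rewrite size_poly0.
have : (size (c * 'X^M)%R <= N + M.+1)%N.
  rewrite E mulrC (leq_trans (size_polyMleq _ _)) // size_polyXn addnS /= addnC.
  by rewrite leq_add2l size_poly.
by rewrite size_mulXn // addnS -addSn addnC leq_add2r.
Qed.

End IntegralInfinity.

Lemma algebraic_minpoly (K F : fieldType) (j : {rmorphism K -> F}) y :
  algebraicOver j y ->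
  exists p : {poly K}, [/\ p \is monic, irreducible_poly p &
    forall q, root (map_poly j q) y = (p %| q)].
Proof.
move=> /integral_algebraic[p0 mp0 rp0].
have [n] := ubnP (size p0); elim: n p0 mp0 rp0 => // n IHn p mp rp; rewrite ltnS => sp.
have [[p' [mp' rp' sp']]|nop] := EM (exists p' : {poly K},
    [/\ p' \is monic, root (map_poly j p') y & (size p' < size p)%N]).
  by apply: (IHn p') => //; apply: leq_trans sp.
have minp q : root (map_poly j q) y -> (size q < size p)%N -> q = 0.
  move=> qy sq; apply/eqP; apply: contraT => q0; case: nop.
  have lq : (lead_coef q)^-1 != 0 by rewrite invr_eq0 lead_coef_eq0.
  exists ((lead_coef q)^-1 *: q); split.
  - by rewrite monicE lead_coefZ mulVf ?lead_coef_eq0.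
  - by rewrite rootE map_polyZ hornerZ (rootP qy) mulr0.
  - by rewrite size_scale.
have rootdvd q : root (map_poly j q) y = (p %| q).
  apply/idP/idP => [qy|]; last first.
    by case/dvdpP => r ->; rewrite rmorphM rootM rp orbT.
  apply/eqP; apply: minp; last by rewrite ltn_modp monic_neq0.
  move: qy; rewrite {1}(divp_eq q p) rmorphD rmorphM /= rootE hornerD hornerM.
  by rewrite (rootP rp) mulr0 add0r.
exists p; split=> //; split=> [|q sq qp].
  rewrite ltnNge; apply/negP => /size1_polyC E; move: rp mp.
  rewrite E map_polyC rootC fmorph_eq0 => /eqP->.
  by rewrite polyC0 monicE lead_coef0 eq_sym oner_eq0.
have q0 : q != 0 by apply: contraTneq qp => ->; rewrite dvd0p monic_neq0.
have /dvdpP[r Er] := qp.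
have r0 : r != 0 by apply: contraTneq (monic_neq0 mp) => r0; rewrite Er r0 mul0r eqxx.
have := rp; rewrite {1}Er rmorphM rootM => /orP[ry|qy]; last first.
  by rewrite /eqp qp -rootdvd.
have := minp _ ry; rewrite {1}Er size_mul // => H; exfalso.
move: r0; rewrite H ?eqxx //.
move: sq; case: (size q) (size_poly_gt0 q) => [|[|m]]; rewrite ?q0 // addnS /= => _ _.
by rewrite -addSnnS leq_addr.
Qed.

Lemma left_kernel (K : fieldType) m n (A : 'M[K]_(m, n)) : (n < m)%N ->
  exists2 v : 'rV[K]_m, v != 0 & v *m A = 0.
Proof.
move=> nm; have : kermx A != 0.
  rewrite kermx_eq0 /row_free; apply/eqP => rA.
  by have := rank_leq_col A; rewrite rA leqNgt nm.
move=> /rowV0Pn[v vA v0]; exists v => //; exact/sub_kermxP.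
Qed.

Lemma coef_bound (K : fieldType) (Q : {poly {poly K}}) :
  exists r, forall n, (size (Q`_n)%R <= r.+1)%N.
Proof.
exists (\max_(n < size Q) size (Q`_n)%R) => n.
have [sn|sn] := leqP (size Q) n; first by rewrite nth_default // size_poly0.
by rewrite leqW // (leq_bigmax (Ordinal sn)).
Qed.

(** * Traces and the span of the translates of an integral element *)

Section Trace.
Variables (K : fieldType) (F : closedFieldType) (j : {rmorphism K -> F}) (x : F).
Variable h : {rmorphism F -> F}.
Hypothesis char0 : [pchar K] =i pred0.
Hypothesis Kclosed : forall a, algebraicOver j a -> exists b, a = j b.
Hypothesis xtr : ~ algebraicOver j x.
Hypothesis hj : forall a, h (j a) = j a.
Hypothesis hx : h x = x + 1.
Local Notation ev := (evalX j x).
Local Notation sh := (comp_poly ('X + 1%:P)) (only parsing).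

(** [L] stands for [K(x)] and is known only through its image, because it will be supplied as a
    subfield of [F]. *)
Variables (L : fieldType) (i : {rmorphism L -> F}).
Hypothesis rangeL : forall y, (exists b, y = i b) <->
  (exists p q, ev q != 0 /\ y = ev p / ev q).

Lemma evL p : {b | i b = ev p}.
Proof.
apply: sig_eqW; have /rangeL[b ->] : exists p' q, ev q != 0 /\ ev p = ev p' / ev q.
  by exists p, 1; rewrite rmorph1 oner_neq0 divr1.
by exists b.
Qed.

Lemma clear_denominators (p : {poly L}) :
  exists2 d, ev d != 0 & exists P, map_poly ev P = ev d *: map_poly i p.
Proof.
elim/poly_ind: p => [|p c [d d0 [P EP]]].
  by exists 1; rewrite ?rmorph1 ?oner_neq0 //; exists 0; rewrite !rmorph0 scaler0.
have /rangeL[a [b [b0 Ec]]] : exists c', i c = i c' by exists c.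
exists (d * b); first by rewrite rmorphM mulf_neq0.
exists (b%:P * P * 'X + (d * a)%:P).
rewrite !rmorphD !rmorphM /= !map_polyX !map_polyC /= EP Ec scalerDr -!mul_polyC.
rewrite !rmorphM /=; congr (_ + _); first by ring.
by rewrite -!rmorphM; congr (_%:P); field.
Qed.

Definition liftL := map_poly (fun p => sval (evL p)).

Lemma liftLE A : map_poly i (liftL A) = map_poly ev A.
Proof.
apply/polyP => n; rewrite coef_map !coef_poly /=; case: ifP => _; last exact: rmorph0.
by rewrite (svalP (evL _)).
Qed.

Lemma algXP y : algX j x y <-> algebraicOver i y.
Proof.
split=> [[A A0 Ay]|[p p0 py]].
  exists (liftL A); rewrite ?liftLE //.
  have ec0 : sval (evL (lead_coef A)) != 0.
    by rewrite -(fmorph_eq0 i) (svalP (evL _)) evalX_eq0 // lead_coef_eq0.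
  apply: contraNneq ec0 => /(congr1 (fun p : {poly L} => p`_(size A).-1)).
  rewrite coef0 coef_poly; case: ltnP => [_ ->//|].
  by rewrite -ltnS prednK ?ltnn ?size_poly_gt0.
have [d d0 [P EP]] := clear_denominators p; exists P.
  apply: contraNneq p0 => P0; move: EP; rewrite P0 rmorph0 => /esym/eqP.
  by rewrite scaler_eq0 (negPf d0) map_poly_eq0.
by rewrite EP rootE hornerZ (rootP py) mulr0.
Qed.

Lemma algX_iter g s : algX j x g -> algX j x (iter s h g).
Proof.
move=> ag; elim: s => //= s [A A0 /rootP Ay]; exists (map_poly sh A).
  apply: contraNneq A0 => /(congr1 (fun p : {poly {poly K}} => p`_(size A).-1)).
  rewrite coef_map coef0 /= => E.
  by rewrite -lead_coef_eq0 -size_poly_eq0 -size_shift E size_poly0.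
apply/rootP; rewrite -[RHS](rmorph0 h) -Ay -horner_map -!map_poly_comp.
by congr (_.[_]); apply: eq_map_poly => a /=; rewrite (evalX_shift hj hx).
Qed.

(** The sum is [q(h)] applied to [g]. A root of [q] in [F] is algebraic over [K], so it lies in [K],
    and a factor [X - lam] splits off: with [q = q' * (X - lam)], the element [q'(h) g] satisfies
    the hypothesis of [translation_affine_eigen], hence is a polynomial in [x], and [q'] has smaller
    degree. *)
Lemma translation_operator (q : {poly K}) n g p : q != 0 -> (size q <= n)%N -> algX j x g ->
  \sum_(s < n) j q`_s * iter s h g = ev p -> exists p, g = ev p.
Proof.
move=> q0 sq ag; have [m] := ubnP (size q); elim: m q n p q0 sq => // m IHm q n p q0 sq.
rewrite ltnS => sm E; have [sq1|sq1] := leqP (size q) 1.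
  have Eq := size1_polyC sq1.
  have c0 : q`_0 != 0 by apply: contraNneq q0 => c0; rewrite Eq c0 polyC0.
  exists ((q`_0)^-1 *: p); rewrite -mul_polyC rmorphM /= evalXC -E fmorphV.
  case: n {IHm E} sq => [|n] sq; first by move: q0; rewrite -size_poly_leq0 sq.
  rewrite big_ord_recl big1 ?addr0 /= ?mulKf ?fmorph_eq0 // => s _.
  by rewrite Eq coefC /= rmorph0 mul0r.
have /closed_rootP[z rz] : size (map_poly j q) != 1%N.
  by rewrite size_map_poly neq_ltn sq1 orbT.
have [|lam Ez] := Kclosed (a := z); first by exists q.
move: rz; rewrite Ez fmorph_root => /factor_theorem[q' Eq].
have q'0 : q' != 0 by apply: contraNneq q0 => q'0; rewrite Eq q'0 mul0r.
have szq : size q = (size q').+1 by rewrite Eq size_mul ?polyXsubC_eq0 // size_XsubC addn2.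
case: n => [|n] in sq E *; first by move: q0; rewrite -size_poly_leq0 sq.
have sq' : (size q' <= n)%N by rewrite -ltnS -szq.
pose g' := \sum_(s < n) j q'`_s * iter s h g.
have Eg' : h g' - j lam * g' = ev p.
  rewrite -E Eq; under [RHS]eq_bigr => s _.
    rewrite mulrBr coefB coefMX coefMC rmorphB mulrBl rmorphM /=; over.
  rewrite sumrB /=; congr (_ - _).
    rewrite big_ord_recl /= rmorph0 mul0r add0r rmorph_sum; apply: eq_bigr => s _ /=.
    by rewrite rmorphM /= hj.
  rewrite big_ord_recr /= [q'`_n]nth_default // rmorph0 !mul0r addr0 mulr_sumr.
  by apply: eq_bigr => s _; rewrite mulrCA mulrA.
have ag' : algX j x g'.
  apply/algXP; rewrite /g'; elim/big_ind: _ => [|a b|s _].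
  - exact: algebraic0.
  - exact: algebraic_add.
  apply: algebraic_mul; last exact/algXP/algX_iter.
  by rewrite -(evalXC j x) -(svalP (evL _)); apply: algebraic_id.
have [p' Ep'] := translation_affine_eigen char0 Kclosed hj hx ag' Eg'.
by apply: (IHm q' n p' q'0 sq') => //; rewrite -szq.
Qed.

(** Galois descent to [K(x)]; for subfields of [F] it will follow from [exists_Gcirc_moving]. *)
Hypothesis galois : forall t, algebraicOver i t ->
  (forall u : {rmorphism F -> F}, (forall b, u (i b) = i b) -> u t = t) ->
  exists b, t = i b.

(* The traces of [h^s(a) th^l] from [L(th)] to [L] are polynomials in [x] of
   degree bounded independently of [s]; as the trace form is nondegenerate, the
   translates of [a] span a space of finite dimension over the constants. *)
Lemma translation_finite_span a th (P : nat -> {poly L}) : algebraicOver i th ->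
    (forall s, iter s h a = (map_poly i (P s)).[th]) -> integralOver ev a ->
  exists2 q : {poly K}, q != 0 &
    exists2 n, (size q <= n)%N & \sum_(s < n) j q`_s * iter s h a = 0.
Proof.
move=> ath EP [Q mQ Qa].
(* The generator may be taken integral over [K[x]], which makes the traces integral; the multiple
   [ev c * th] that achieves this is constructed at the end. *)
suff [th' [ath' [P' EP'] [R mR Rth]]] : exists th', [/\ algebraicOver i th',
    exists P', forall s, iter s h a = (map_poly i (P' s)).[th'] & integralOver ev th'].
  move: ath' EP' Rth => {P th ath EP}; move: th' P' => th P ath EP Rth.
  have [mu [mmu irr rmu]] := algebraic_minpoly ath.
  have [rs0 Ers] := closed_field_poly_normal (map_poly i mu).
  pose rs := undup rs0.
  have rsP z : (z \in rs) = root (map_poly i mu) z.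
    by rewrite mem_undup Ers rootZ ?lead_coef_eq0 ?map_poly_eq0 ?monic_neq0 // root_prod_XsubC.
  have urs : uniq rs by apply: undup_uniq.
  have thrs : th \in rs by rewrite rsP rmu.
  (* The minimal polynomial [mu] divides [liftL S \Po Pt], so a relation over [K[x]] satisfied at
     [th] passes to all conjugates of [th]. *)
  have conj_root (Pt : {poly L}) (S : {poly {poly K}}) z : z \in rs ->
      root (map_poly ev S) (map_poly i Pt).[th] -> root (map_poly ev S) (map_poly i Pt).[z].
    rewrite rsP => zr; have E y : root (map_poly ev S) (map_poly i Pt).[y] =
        root (map_poly i (liftL S \Po Pt)) y.
      by rewrite [RHS]rootE map_comp_poly horner_comp liftLE.
    by rewrite !E rmu => /dvdpP[w ->]; rewrite rmorphM rootM zr orbT.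
  have [rQ sQ] := coef_bound Q; have [rR sR] := coef_bound R.
  (* Shifting the coefficients preserves their degrees: [rQ] controls the pole at infinity of every
     translate of [a], uniformly in [s]. *)
  pose Qs s := iter s (map_poly sh) Q.
  have Qs_prop s : [/\ Qs s \is monic, forall n, (size ((Qs s)`_n)%R <= rQ.+1)%N &
      root (map_poly ev (Qs s)) (iter s h a)].
    elim: s => [|s [mQs sQs rQs]]; first by [].
    split=> [|n|]; first exact: monic_map.
      by rewrite /= coef_map /= size_shift.
    apply/rootP => /=; rewrite -[RHS](rmorph0 h) -(rootP rQs) -horner_map -!map_poly_comp.
    by congr (_.[_]); apply: eq_map_poly => p /=; rewrite (evalX_shift hj hx).
  (* [N] bounds the pole order at infinity of the traces: at most [rQ] comes from the translate of
     [a], and at most [rR * l] from the power of index [l < d] of a conjugate of [th]. *)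
  pose d := size rs; pose N := (rQ + rR * d)%N.
  pose v s z := (map_poly i (P s)).[z].
  pose t s l := \sum_(z <- rs) v s z * z ^+ l.
  have alg_rs z : z \in rs -> algebraicOver i z.
    by rewrite rsP => zr; exists mu; rewrite ?monic_neq0.
  have alg_v s z : z \in rs -> algebraicOver i (v s z).
    move=> /alg_rs az; apply/integral_algebraic/integral_horner; last exact/integral_algebraic.
    by apply/integral_poly => n; rewrite coef_map; apply: integral_id.
  have tL s l : exists b, t s l = i b.
    apply: galois => [|u ui].
      rewrite /t big_seq; elim/big_ind: _ => [|y1 y2|z zrs].
      - exact: algebraic0.
      - exact: algebraic_add.
      apply: algebraic_mul; first exact: alg_v.
      by apply/integral_algebraic; elim: l => [|l IHl]; rewrite ?expr0 ?exprS;
        [exact: integral1|apply: integral_mul => //; apply/integral_algebraic/alg_rs].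
    have upoly (p : {poly L}) : map_poly u (map_poly i p) = map_poly i p.
      by rewrite -map_poly_comp; apply: eq_map_poly => b /=; rewrite ui.
    have uu : uniq (map u rs) by rewrite map_inj_uniq //; apply: fmorph_inj.
    have su : {subset map u rs <= rs}.
      move=> _ /mapP[z zrs ->]; move: zrs; rewrite !rsP => /rootP zr.
      by rewrite rootE -upoly horner_map zr rmorph0.
    have [_ eu] := uniq_min_size uu su (eq_leq (esym (size_map u rs))).
    rewrite /t rmorph_sum -[RHS](perm_big _ (uniq_perm uu urs eu)) big_map /=.
    by apply: eq_bigr => z _; rewrite rmorphM rmorphXn /= /v -[in RHS]upoly horner_map.
  have tE s l : (l < d)%N -> exists c : {poly K}, (size c <= N.+1)%N && (t s l == ev c).
    move=> ld; have [b Eb] := tL s l.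
    suff [c sc ->] : exists2 c : {poly K}, (size c <= N.+1)%N & t s l = ev c.
      by exists c; rewrite sc eqxx.
    have [mQs sQs rQs] := Qs_prop s.
    have Rv z : z \in rs -> root (map_poly ev R) z.
      by move=> zrs; have := conj_root 'X R z zrs; rewrite map_polyX !hornerX; apply.
    have Qv z : z \in rs -> root (map_poly ev (Qs s)) (v s z).
      by move=> zrs; apply: conj_root; rewrite -?EP.
    have intX (A B : comNzRingType) (f : {rmorphism A -> B}) y n :
        integralOver f y -> integralOver f (y ^+ n).
      move=> iy; elim: n => [|n IHn]; rewrite ?expr0 ?exprS; first exact: integral1.
      exact: integral_mul.
    apply: (frac_integral_size xtr); first by apply/rangeL; exists b.
      rewrite /t big_seq; elim/big_ind: _ => [|y1 y2|z zrs].
      - exact: mxpoly.integral0.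
      - exact: integral_add.
      apply: integral_mul; first by exists (Qs s) => //; apply: Qv.
      by apply: intX; exists R => //; apply: Rv.
    rewrite /t mulr_suml big_seq; elim/big_ind: _ => [|y1 y2|z zrs].
    - exact: mxpoly.integral0.
    - exact: integral_add.
    have x0 := transcendental_neq0 xtr.
    have eN : N = (rQ + rR * l + rR * (d - l))%N by rewrite -addnA -mulnDr subnKC // ltnW.
    have -> : v s z * z ^+ l / x ^+ N =
        v s z / x ^+ rQ * (z / x ^+ rR) ^+ l * x^-1 ^+ (rR * (d - l)).
      rewrite eN !exprD [x ^+ (rR * l)]exprM expr_div_n exprVn.
      by field; rewrite !expf_neq0.
    apply: integral_mul; last first.
      have -> : x^-1 ^+ (rR * (d - l)) = evalX j x^-1 ('X^(rR * (d - l))).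
          by rewrite rmorphXn /= evalX_X.
        exact: integral_id.
    apply: integral_mul; first by apply: (integral_infinity xtr mQs sQs); apply: Qv.
    by apply: intX; apply: (integral_infinity xtr mR sR); apply: Rv.
  pose c s (l : 'I_d) := sval (sigW (tE s l (ltn_ord l))).
  have cP s l : (size (c s l) <= N.+1)%N /\ t s l = ev (c s l).
    by rewrite /c; case: sigW => c' /= /andP[sc /eqP].
  (* Each translate has [d] traces with [N.+1] coefficients each, so that [D.+1] translates have
     linearly dependent vectors of traces. *)
  pose D := (d * N.+1)%N.
  pose A := \matrix_(s < D.+1) mxvec (\matrix_(l < d, m < N.+1) (c s l)`_m).
  have [w w0 wA] := left_kernel A (ltnSn D).
  exists (rVpoly w).
    by apply: contraNneq w0 => w0; rewrite -[w]rVpolyK w0 linear0.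
  exists D.+1; first exact: size_poly.
  have cw l : \sum_(s < D.+1) w 0 s *: c s l = 0.
    apply/polyP => m; rewrite coef0 coef_sum; under eq_bigr do rewrite coefZ.
    have [mN|Nm] := ltnP m N.+1; last first.
      by apply: big1 => s _; rewrite nth_default ?mulr0 // (leq_trans (cP s l).1).
    transitivity ((w *m A) 0 (mxvec_index l (Ordinal mN))); last by rewrite wA mxE.
    by rewrite [RHS]mxE; apply: eq_bigr => s _; rewrite mxE mxvecE mxE.
  pose y z := \sum_(s < D.+1) j (w 0 s) * v s z.
  have yz0 (g : {poly F}) : (size g <= d)%N -> \sum_(z <- rs) y z * g.[z] = 0.
    move=> sg; under eq_bigr do rewrite (horner_coef_wide _ sg) mulr_sumr.
    rewrite exchange_big big1 //= => l _.
    under eq_bigr do rewrite mulrCA.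
    rewrite -mulr_sumr; apply/eqP; rewrite mulf_eq0; apply/orP; right; apply/eqP.
    under eq_bigr do rewrite mulr_suml.
    rewrite exchange_big /=; transitivity (ev (\sum_(s < D.+1) w 0 s *: c s l)).
      rewrite rmorph_sum; apply: eq_bigr => s _.
      rewrite -mul_polyC rmorphM /= evalXC -(cP s l).2 mulr_sumr.
      by apply: eq_bigr => z _; rewrite mulrA.
    by rewrite cw rmorph0.
  have d0 : (0 < d)%N by rewrite /d; case: (rs) thrs.
  (* Nondegeneracy of the trace form in explicit terms: [g] vanishes at every conjugate except [th],
     so that the sum in [yz0] reduces to its term at [th]. *)
  pose g := \prod_(z <- rem th rs) ('X - z%:P).
  have sg : (size g <= d)%N by rewrite size_prod_XsubC size_rem // prednK.
  have gr z : (g.[z] == 0) = (z \in rem th rs) by rewrite -root_prod_XsubC.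
  have := yz0 g sg; rewrite (big_rem th) //= big_seq big1 ?addr0 => [/eqP|z]; last first.
    by rewrite -gr => /eqP ->; rewrite mulr0.
  rewrite mulf_eq0 gr mem_rem_uniq // inE eqxx orbF => /eqP yth.
  rewrite -[RHS]yth; apply: eq_bigr => s _; rewrite coef_rVpoly_ord EP //.
have [A A0 Ath] := (algXP th).2 ath.
have [c c0 ic] := integral_scale xtr A0 Ath.
have ec : i (sval (evL c)) = ev c by apply: svalP (evL c).
have ec0 : ev c != 0 by rewrite evalX_eq0.
exists (ev c * th); split => //.
  by apply: algebraic_mul => //; rewrite -ec; apply: algebraic_id.
exists (fun s => P s \Po ((sval (evL c))^-1 *: 'X)) => s.
rewrite EP map_comp_poly horner_comp linearZ /= map_polyX hornerZ hornerX.
by rewrite fmorphV ec mulKf.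
Qed.

Lemma translation_integral_polynomial a th (P : nat -> {poly L}) : algebraicOver i th ->
    (forall s, iter s h a = (map_poly i (P s)).[th]) -> integralOver ev a ->
  exists p, a = ev p.
Proof.
move=> ath EP ia; have [q q0 [n sq E]] := translation_finite_span ath EP ia.
apply: (translation_operator q0 sq (p := 0)); last by rewrite rmorph0.
by case: ia => Q mQ rQ; exists Q; rewrite ?monic_neq0.
Qed.

End Trace.

(** * Subfields and extension of isomorphisms *)

Section SubfieldType.
Variables (F : fieldType) (S : divringClosed F).

Record subfield_sort := SubfieldSort { subfield_val : F; _ : subfield_val \in S }.

HB.instance Definition _ := [isSub for subfield_val].
HB.instance Definition _ := [Choice of subfield_sort by <:].
HB.instance Definition _ := [SubChoice_isSubComUnitRing of subfield_sort by <:].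
HB.instance Definition _ := [SubComUnitRing_isSubIntegralDomain of subfield_sort by <:].
HB.instance Definition _ := [SubIntegralDomain_isSubField of subfield_sort by <:].

End SubfieldType.

(** Polynomials over a subfield require a [fieldType]. The conclusion is an equality of sets so that
    [K] can be rewritten as a range wherever it occurs. *)
Lemma subfield_type (F : fieldType) (K : set F) : GRing.divring_closed [in K] ->
  exists (L : fieldType) (j : {rmorphism L -> F}), K = range j.
Proof.
move=> K_closed.
pose S0 : F -> bool := [in K].
pose m := GRing.isDivringClosed.Build F S0 K_closed.
pose S : divringClosed F := HB.pack S0 m.
exists (subfield_sort S : fieldType), (val : {rmorphism _ -> _}).
apply/seteqP; split=> [x Kx|_ [[x xS] _ <-]]; last exact: set_mem.
by exists (@SubfieldSort F S x (mem_set Kx)).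
Qed.

Lemma poly_range (L F : fieldType) (j : {rmorphism L -> F}) (p : {poly F}) :
  (forall i, range j p`_i) -> exists q, p = map_poly j q.
Proof.
move=> pK; have /choice[f Ef] i : exists a, j a = p`_i by case: (pK i) => a _; exists a.
exists (\poly_(i < size p) f i); apply/polyP => i; rewrite coef_map coef_poly /=.
case: ltnP => [_|sp]; first by rewrite Ef.
by rewrite rmorph0 nth_default.
Qed.

Lemma prod_XsubC_range (L F : fieldType) (j : {rmorphism L -> F}) (r : seq F) :
  {in r, forall z, range j z} -> exists q, \prod_(z <- r) ('X - z%:P) = map_poly j q.
Proof.
elim: r => [|z r IHr] rj; first by exists 1; rewrite big_nil rmorph1.
have [q Eq] : exists q, \prod_(z <- r) ('X - z%:P) = map_poly j q.
  by apply: IHr => w wr; apply: rj; rewrite inE wr orbT.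
have [c _ Ec] := rj z (mem_head _ _).
by exists (('X - c%:P) * q); rewrite big_cons Eq rmorphM rmorphB /= map_polyX map_polyC /= Ec.
Qed.

Lemma algebraic_overP (L F : fieldType) (j : {rmorphism L -> F}) x :
  algebraic_over (range j) x <-> algebraicOver j x.
Proof.
split=> [[p [p0 pK px]]|[p p0 px]].
  have [q Eq] := poly_range pK; exists q; rewrite -?Eq //.
  by apply: contraNneq p0 => q0; rewrite Eq q0 rmorph0.
exists (map_poly j p); split=> [|i|//]; first by rewrite map_poly_eq0.
by rewrite coef_map; exists p`_i.
Qed.

(* Graphs of isomorphisms between subfields of [F]. *)
Definition partial_iso (F : fieldType) (D : set (F * F)) : Prop :=
  [/\ D (1, 1), forall p q, D p -> D q -> D (p.1 - q.1, p.2 - q.2),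
    forall p q, D p -> D q -> D (p.1 * q.1, p.2 * q.2),
    forall p, D p -> D (p.1^-1, p.2^-1) &
    forall p, D p -> (p.1 == 0) = (p.2 == 0)].

(** * Extension of partial isomorphisms by Zorn's lemma *)

Section PartialIso.
Variable F : closedFieldType.
Implicit Type D : set (F * F).

(** A graph is convenient for unions of chains, a field with two embeddings for transporting
    polynomials. The condition on zeros applied to differences makes the graph functional. *)
Lemma partial_iso_type D : partial_iso D ->
  exists (L : fieldType) (j1 j2 : {rmorphism L -> F}), D = range (fun a => (j1 a, j2 a)).
Proof.
move=> [D1 DB DM DV D0].
have E x : x \in fst @` D <-> exists y, D (x, y).
  split=> [/set_mem[[x1 y] Dy /= <-]|[y Dy]]; first by exists y.
  by apply: mem_set; exists (x, y).
have [|L [j1 Ej1]] := @subfield_type F (fst @` D).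
  split=> [|x y /E[x' Dx] /E[y' Dy]|x y /E[x' Dx] /E[y' Dy]]; apply/E.
  - by exists 1.
  - by exists (x' - y'); apply: (DB _ _ Dx Dy).
  - by exists (x' / y'); apply: (DM _ _ Dx (DV _ Dy)).
have D_fun x y z : D (x, y) -> D (x, z) -> y = z.
  move=> Dy Dz; have /D0 := DB _ _ Dy Dz.
  by rewrite /= subrr eqxx => /esym; rewrite subr_eq0 => /eqP.
have /choice[f Df] a : exists b, D (j1 a, b).
  by apply/E/mem_set; rewrite Ej1; exists a.
have fB : zmod_morphism f.
  by move=> a b; apply: (D_fun (j1 (a - b))) => //; rewrite rmorphB; apply: (DB _ _ (Df a) (Df b)).
have fM : monoid_morphism f.
  split; first by apply: (D_fun (j1 1)) => //; rewrite rmorph1.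
  by move=> a b; apply: (D_fun (j1 (a * b))) => //; rewrite rmorphM; apply: (DM _ _ (Df a) (Df b)).
pose fB' := GRing.isZmodMorphism.Build L F f fB.
pose fM' := GRing.isMonoidMorphism.Build L F f fM.
pose j2 : {rmorphism L -> F} := HB.pack f fB' fM'.
exists L, j1, j2; apply/seteqP; split=> [[x y] Dxy|_ [a _ <-]]; last exact: Df.
have : (fst @` D) x by exists (x, y).
rewrite Ej1 => -[a _ ax]; exists a => //; rewrite ax; congr (_, _).
by apply: (D_fun x) => //; rewrite -ax; apply: Df.
Qed.

(** Values of polynomials already form a field, and the same Bezout coefficient [v] inverts the
    values of [q] at both [a] and [b]. *)
Lemma partial_iso_adjoin (L : fieldType) (j1 j2 : {rmorphism L -> F}) p a b :
    irreducible_poly p -> root (map_poly j1 p) a -> root (map_poly j2 p) b ->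
  partial_iso (range (fun q => ((map_poly j1 q).[a], (map_poly j2 q).[b]))).
Proof.
move=> irr pa pb.
have root_dvd (i : {rmorphism L -> F}) c q : root (map_poly i p) c ->
    ((map_poly i q).[c] == 0) = (p %| q).
  move=> pc; have [/dvdpP[r ->]|] := boolP (p %| q).
    by rewrite -rootE rmorphM rootM pc orbT.
  rewrite -irreducible_poly_coprime // => /Bezout_eq1_coprimepP[[u v] /= Euv].
  apply/negbTE/eqP => qc; move: (congr1 (fun r => (map_poly i r).[c]) Euv).
  rewrite /= rmorphD !rmorphM /= hornerD !hornerM qc (rootP pc) !mulr0 addr0.
  by rewrite rmorph1 hornerC => /eqP; rewrite eq_sym oner_eq0.
split=> [|_ _ [q _ <-] [r _ <-]|_ _ [q _ <-] [r _ <-]|_ [q _ <-]|_ [q _ <-]] /=.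
- by exists 1; rewrite ?rmorph1 ?hornerC.
- by exists (q - r); rewrite ?rmorphB /= ?hornerD ?hornerN.
- by exists (q * r); rewrite ?rmorphM /= ?hornerM.
- have [/dvdpP[r ->]|] := boolP (p %| q).
    exists 0; rewrite // !rmorph0 !horner0 !rmorphM /= !hornerM.
    by rewrite (rootP pa) (rootP pb) !mulr0 invr0.
  rewrite -irreducible_poly_coprime // => /Bezout_eq1_coprimepP[[u v] /= Euv].
  exists v => //; have ev_inv (i : {rmorphism L -> F}) c : root (map_poly i p) c ->
      (map_poly i v).[c] = (map_poly i q).[c]^-1.
    move=> pc; move: (congr1 (fun r => (map_poly i r).[c]) Euv).
    rewrite /= rmorphD !rmorphM /= hornerD !hornerM (rootP pc) !mulr0 add0r.
    rewrite rmorph1 hornerC => vq1.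
    have q0 : (map_poly i q).[c] != 0.
      by apply/eqP => q0; move/eqP: vq1; rewrite q0 mulr0 eq_sym oner_eq0.
    by rewrite -[LHS](mulfK q0) vq1 mul1r.
  by rewrite !ev_inv.
- by rewrite !root_dvd.
Qed.

Lemma partial_iso_swap D : partial_iso D -> partial_iso [set p | D (p.2, p.1)].
Proof.
move=> [D1 DB DM DV D0]; split=> //= [p q Dp Dq|p q Dp Dq|p Dp|p Dp].
- exact: (DB _ _ Dp Dq).
- exact: (DM _ _ Dp Dq).
- exact: (DV _ Dp).
- by have /= -> := D0 _ Dp.
Qed.

Lemma partial_iso_extend D a : partial_iso D ->
    algebraic_over (fst @` D) a ->
  exists D' b, [/\ partial_iso D', D `<=` D' & D' (a, b)].
Proof.
move=> /partial_iso_type[L [j1 [j2 ->]]].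
have -> : fst @` range (fun a => (j1 a, j2 a)) = range j1.
  apply/seteqP; split=> [_ [_ [c _ <-] <-]|_ [c _ <-]]; first by exists c.
  by exists (j1 c, j2 c) => //; exists c.
move=> /algebraic_overP aa; have [p [_ irr rp]] := algebraic_minpoly aa.
have [sp _] := irr.
have /closed_rootP[b pb] : size (map_poly j2 p) != 1%N by rewrite size_map_poly neq_ltn sp orbT.
have pa : root (map_poly j1 p) a by rewrite rp.
exists (range (fun q => ((map_poly j1 q).[a], (map_poly j2 q).[b]))), b; split.
- exact: partial_iso_adjoin irr pa pb.
- by move=> _ [c _ <-]; exists c%:P; rewrite // !map_polyC !hornerC.
- by exists 'X; rewrite // !map_polyX !hornerX.
Qed.

Lemma partial_iso_bigcup (C : set (set (F * F))) D0 :
  C D0 -> C `<=` @partial_iso F -> total_on C subset -> partial_iso (\bigcup_(D in C) D).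
Proof.
move=> CD0 Cp Ct.
have two p q : (\bigcup_(D in C) D) p -> (\bigcup_(D in C) D) q ->
    exists D, [/\ C D, D p & D q].
  move=> [D1 CD1 D1p] [D2 CD2 D2q].
  by have [s|s] := Ct _ _ CD1 CD2; [exists D2|exists D1]; split=> //; apply: s.
split=> [|p q Dp Dq|p q Dp Dq|p [D CD Dp]|p [D CD Dp]].
- by exists D0 => //; case: (Cp _ CD0).
- have [D [CD Dp' Dq']] := two _ _ Dp Dq; exists D => //.
  by case: (Cp _ CD) => _ DB _ _ _; apply: DB.
- have [D [CD Dp' Dq']] := two _ _ Dp Dq; exists D => //.
  by case: (Cp _ CD) => _ _ DM _ _; apply: DM.
- by exists D => //; case: (Cp _ CD) => _ _ _ DV _; apply: DV.
- by case: (Cp _ CD) => _ _ _ _; apply.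
Qed.

(** A maximal graph containing [D0] is total by [partial_iso_extend], and surjective by the same
    lemma applied to its transpose; this is why algebraicity is required over both projections. *)
Lemma partial_iso_total D0 : partial_iso D0 ->
    (forall x, algebraic_over (fst @` D0) x) -> (forall x, algebraic_over (snd @` D0) x) ->
  exists2 f : {rmorphism F -> F}, bijective f & forall p, D0 p -> f p.1 = p.2.
Proof.
move=> pD0 alg1 alg2.
pose P D := D = set0 \/ (partial_iso D /\ D0 `<=` D).
have [C CP Ct|D [PD maxD]] := @Zorn_bigcup _ P.
  have [[D1 [CD1 D1n]]|nC] := EM (exists D, C D /\ D !=set0); last first.
    left; apply/seteqP; split=> // p [D CD Dp]; apply: nC; exists D; split=> //; by exists p.
  right; pose C' := [set D | C D /\ D !=set0].
  have C'P D : C' D -> partial_iso D /\ D0 `<=` D.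
    by case=> /CP[->|//] [p []].
  have -> : \bigcup_(X in C) X = \bigcup_(X in C') X.
    apply/seteqP; split=> p [D CD Dp]; last by exists D => //; case: CD.
    by exists D => //; split=> //; exists p.
  split.
    apply: (@partial_iso_bigcup _ D1) => // [D /C'P[]//|].
    by move=> X Y [CX _] [CY _]; apply: Ct.
  by move=> p D0p; exists D1 => //; have [_] := C'P D1 (conj CD1 D1n); apply.
have {PD}[pD sD] : partial_iso D /\ D0 `<=` D.
  case: PD => // DE; case: (maxD D0); last by right; split.
  rewrite DE; split; first by [].
  by move=> /(_ (1, 1)); apply; case: pD0.
have maxD' D' : partial_iso D' -> D `<=` D' -> D' `<=` D.
  move=> pD' sDD'; apply: contrapT => nsub; case: (maxD D'); first exact: conj sDD' nsub.
  by right; split => //; apply: subset_trans sDD'.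
have mono (A B : set F) x : A `<=` B -> algebraic_over A x -> algebraic_over B x.
  by move=> sAB [p [p0 pA px]]; exists p; split=> // i; apply: sAB.
have onto1 a : exists b, D (a, b).
  have [|D' [b [pD' sDD' D'ab]]] := @partial_iso_extend D a pD.
    by apply: mono (alg1 a); apply: image_subset.
  by exists b; apply: maxD' D'ab.
have onto2 b : exists a, D (a, b).
  have [|D' [a [pD' sDD' D'ab]]] := @partial_iso_extend _ b (partial_iso_swap pD).
    apply: mono (alg2 b) => _ [p D0p <-]; exists (p.2, p.1) => //.
    by apply: sD; rewrite -surjective_pairing.
  exists a; have := maxD' _ (partial_iso_swap pD'); apply => //.
  by move=> p Dp; apply: sDD'; rewrite /= -surjective_pairing.
have [L [j1 [j2 ED]]] := partial_iso_type pD.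
have /choice[g j1g] x : exists a, j1 a = x.
  by have [b] := onto1 x; rewrite ED => -[a _ [<- _]]; exists a.
have gj1 : cancel j1 g by move=> a; apply: (fmorph_inj j1); rewrite j1g.
have gB : zmod_morphism g := can2_zmod_morphism gj1 j1g.
have gM : monoid_morphism g := can2_monoid_morphism gj1 j1g.
pose gB' := GRing.isZmodMorphism.Build F L g gB.
pose gM' := GRing.isMonoidMorphism.Build F L g gM.
pose gR : {rmorphism F -> L} := HB.pack g gB' gM'.
exists (j2 \o gR : {rmorphism F -> F}).
  have /choice[k Ek] b : exists a, (j2 \o g) a = b.
    by have [a] := onto2 b; rewrite ED => -[c _ [_ <-]]; exists (j1 c); rewrite /= gj1.
  exists k => // x; apply: (fmorph_inj (j2 \o gR : {rmorphism F -> F})); exact: Ek.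
by move=> p /sD; rewrite ED => -[c _ <-] /=; rewrite gj1.
Qed.
End PartialIso.

(** * Relative algebraic closure and simple transcendental extensions *)

Section AlgebraicClosure.
Variables (k F : closedFieldType) (iota : {rmorphism k -> F}).
Implicit Types (A B K : set F) (x y : F).
Local Notation ifield := (intermediate_field iota).
Local Notation adjoin := (adjoin iota).

Lemma ifield_range (L : fieldType) (j : {rmorphism L -> F}) :
  range iota `<=` range j -> ifield (range j).
Proof.
move=> sj; have E y : (y \in range j) <-> exists a, j a = y.
  by split=> [/set_mem[a _ <-]|[a <-]]; [exists a|apply: mem_set; exists a].
split=> //; split=> [|y z /E[a <-] /E[b <-]|y z /E[a <-] /E[b <-]]; apply/E.
- by exists 1; rewrite rmorph1.
- by exists (a - b); rewrite rmorphB.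
- by exists (a / b); rewrite fmorph_div.
Qed.

Lemma ifield_type K : ifield K -> exists (L : fieldType) (j : {rmorphism L -> F}), K = range j.
Proof. by case=> /subfield_type. Qed.

Lemma algebraic_over_sub A B x : A `<=` B -> algebraic_over A x -> algebraic_over B x.
Proof. by move=> sAB [p [p0 pA px]]; exists p; split=> // i; apply: sAB. Qed.

Definition algebraic_closure A := [set x | algebraic_over (adjoin A) x].
Local Notation acl := algebraic_closure.

Lemma adjoin_min A K : ifield K -> A `<=` K -> adjoin A `<=` K.
Proof. by move=> iK AK; apply: smallest_sub. Qed.

Lemma adjoinS A B : A `<=` B -> adjoin A `<=` adjoin B.
Proof.
move=> sAB; apply: adjoin_min; first exact: adjoin_field.
exact: subset_trans sAB (@sub_adjoin _ _ iota B).
Qed.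

Lemma adjoin_id K : ifield K -> adjoin K = K.
Proof. by move=> iK; apply/seteqP; split; [exact: adjoin_min|exact: sub_adjoin]. Qed.

Lemma algebraic_over_mem A x : A x -> ifield A -> algebraic_over A x.
Proof.
move=> Ax /ifield_type[L [j E]]; move: Ax; rewrite E => -[a _ <-].
by apply/algebraic_overP; exact: algebraic_id.
Qed.

Lemma sub_acl A : A `<=` acl A.
Proof. by move=> x Ax; apply: algebraic_over_mem; [exact: sub_adjoin|exact: adjoin_field]. Qed.

Lemma adjoin_sub_acl A : adjoin A `<=` acl A.
Proof. by move=> x Ax; apply: algebraic_over_mem; [|exact: adjoin_field]. Qed.

Lemma acl_sub A B : A `<=` B -> acl A `<=` acl B.
Proof. by move=> sAB x; apply: algebraic_over_sub; apply: adjoinS. Qed.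

Lemma algebraic_over_ifield K : ifield K -> ifield [set x | algebraic_over K x].
Proof.
move=> iK; have [L [j E]] := ifield_type iK; split; last first.
  by move=> x rx; apply: algebraic_over_mem => //; apply: iK.2.
have E' y : (y \in [set x | algebraic_over K x]) <-> algebraicOver j y.
  by rewrite E; split=> [/set_mem/algebraic_overP|/algebraic_overP/mem_set].
split=> [|y z /E' ay /E' az|y z /E' ay /E' az]; apply/E'.
- exact: algebraic1.
- exact: algebraic_sub.
- exact: algebraic_div.
Qed.

Lemma acl_field A : ifield (acl A).
Proof. exact/algebraic_over_ifield/adjoin_field. Qed.

Lemma algebraic_over_trans K x : ifield K ->
  algebraic_over [set y | algebraic_over K y] x -> algebraic_over K x.
Proof.
move=> iK [p [p0 pK px]]; have [L [j E]] := ifield_type iK.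
have pa i : algebraicOver j p`_i by apply/algebraic_overP; rewrite -E; apply: pK.
rewrite E; apply/algebraic_overP/integral_algebraic; apply: (integral_root p0 px).
by apply/integral_poly => i; apply/integral_algebraic.
Qed.

Lemma algebraic_over_acl A x : algebraic_over (acl A) x -> acl A x.
Proof. by apply: algebraic_over_trans; apply: adjoin_field. Qed.

Lemma acl_min A B : A `<=` acl B -> acl A `<=` acl B.
Proof.
move=> sAB x Ax; apply: algebraic_over_acl; apply: algebraic_over_sub Ax.
by apply: adjoin_min => //; apply: acl_field.
Qed.

Lemma adjoin1_frac (L : fieldType) (j : {rmorphism L -> F}) A x : adjoin A = range j ->
  forall y, adjoin (x |` A) y <-> exists p q, evalX j x q != 0 /\ y = evalX j x p / evalX j x q.
Proof.
move=> E; set Q := [set y | exists p q, evalX j x q != 0 /\ y = evalX j x p / evalX j x q].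
have QE y : (y \in Q) <-> Q y by split=> [/set_mem|/mem_set].
suff -> : adjoin (x |` A) = Q by [].
have jQ a : Q (j a).
  by exists a%:P, 1; rewrite rmorph1 oner_neq0 divr1 evalXC.
apply/seteqP; split.
  apply: adjoin_min; last first.
    move=> y [->|Ay]; first by exists 'X, 1; rewrite rmorph1 oner_neq0 divr1 evalX_X.
    have : adjoin A y by exact: sub_adjoin.
    by rewrite E => -[a _ <-].
  split; last first.
    move=> y ry; have : adjoin A y by apply: (adjoin_field iota A).2.
    by rewrite E => -[a _ <-].
  split=> [|y z|y z]; [|move=> /QE[p [q [q0 ->]]] /QE[r [s [s0 ->]]]..]; apply/QE.
  - by rewrite -(rmorph1 j).
  - exists (p * s - r * q), (q * s); rewrite rmorphB !rmorphM mulf_neq0 //; split=> //.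
    by field; rewrite q0 s0.
  have [r0|r0] := eqVneq (evalX j x r) 0.
    by rewrite r0 mul0r invr0 mulr0 -(rmorph0 j).
  exists (p * s), (q * r); rewrite !rmorphM mulf_neq0 //; split=> //.
  by field; rewrite r0 q0 s0.
move=> _ [p [q [_ ->]]].
have [L' [j' E']] := ifield_type (adjoin_field iota (x |` A)).
have evj r : exists b, j' b = evalX j x r.
  suff : range j' (evalX j x r) by case=> b _ <-; exists b.
  have [c Ec] : exists c, j' c = x.
    have : adjoin (x |` A) x by apply: sub_adjoin; left.
    by rewrite E' => -[c _ <-]; exists c.
  have jj' a : exists b, j' b = j a.
    have : adjoin (x |` A) (j a).
      by apply: (@adjoinS A); [move=> ? ?; right|rewrite E; exists a].
    by rewrite E' => -[b _ <-]; exists b.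
  elim/poly_ind: r => [|r a [b _ Eb]]; first by exists 0; rewrite ?rmorph0.
  have [a' Ea] := jj' a; exists (b * c + a') => //.
  by rewrite !rmorphD !rmorphM /= evalXC evalX_X Eb Ec Ea.
by have [[a Ea] [b Eb]] := (evj p, evj q); rewrite E' -Ea -Eb -fmorph_div; exists (a / b).
Qed.

(** If [y] is the value at [x] of [p / q], then [x] is a root of [y q - p], whose coefficients are
    algebraic over [k(A)]. As [x] is transcendental this polynomial is zero, so [y] is a quotient of
    coefficients of [p] and [q]. *)
Lemma adjoin1_algebraic (L : fieldType) (j : {rmorphism L -> F}) A x y : adjoin A = range j ->
  ~ acl A x -> adjoin (x |` A) y -> acl A y -> adjoin A y.
Proof.
rewrite /acl => E /=; rewrite E => xtr.
move/(adjoin1_frac x E) => [p [q [q0 Ey]]] /algebraic_overP ya.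
have [n qn0] : exists n, q`_n != 0.
  exists (size q).-1; rewrite -/(lead_coef q) lead_coef_eq0.
  by apply: contraNneq q0 => ->; rewrite rmorph0.
pose P := y *: map_poly j q - map_poly j p.
have Px : root P x.
  by rewrite rootE /P hornerD hornerN hornerZ -!evalXE Ey divfK // subrr.
have [P0|P0] := eqVneq P 0; last first.
  case: xtr; apply/algebraic_overP/integral_algebraic; apply: (integral_root P0 Px).
  apply/integral_poly => i; rewrite coefB coefZ !coef_map.
  apply: integral_sub; last exact: integral_id.
  by apply: integral_mul; [exact/integral_algebraic|exact: integral_id].
have : P`_n = 0 by rewrite P0 coef0.
rewrite coefB coefZ !coef_map /= => /eqP; rewrite subr_eq0 => /eqP Eq.
exists (p`_n / q`_n) => //; rewrite fmorph_div -Eq mulfK // fmorph_eq0 //.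
Qed.

End AlgebraicClosure.

(** * Galois groups and compact subgroups *)

Section Automorphisms.
Variables (k F : closedFieldType) (iota : {rmorphism k -> F}).
Implicit Types (A B K : set F) (x y : F).
Local Notation ifield := (intermediate_field iota).
Local Notation adjoin := (adjoin iota).
Local Notation acl := (algebraic_closure iota).
Local Notation G := (autk iota).
Local Notation Gc := (Gcirc G).

Definition conjugate K x y := forall p : {poly F}, (forall i, K p`_i) -> root p x -> root p y.

Lemma exists_automorphism K x y : ifield K -> (forall z, algebraic_over K z) ->
  conjugate K x y -> exists2 s : G, fixing K s & s x = y.
Proof.
move=> iK algK cxy; have [L [j E]] := ifield_type iK.
have algj z : algebraicOver j z by apply/algebraic_overP; rewrite -E.
have [p [_ irr rp]] := algebraic_minpoly (algj x).
have py : root (map_poly j p) y.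
  apply: cxy; last by rewrite rp.
  by move=> i; rewrite coef_map E; exists p`_i.
have px : root (map_poly j p) x by rewrite rp.
pose D := range (fun q => ((map_poly j q).[x], (map_poly j q).[y])).
have pD : partial_iso D := partial_iso_adjoin irr px py.
have Dj a : D (j a, j a) by exists a%:P; rewrite // map_polyC !hornerC.
have [||f fb fD] := partial_iso_total pD.
- move=> z; apply: algebraic_over_sub (algK z).
  by rewrite E => _ [a _ <-]; exists (j a, j a).
- move=> z; apply: algebraic_over_sub (algK z).
  by rewrite E => _ [a _ <-]; exists (j a, j a).
have fj a : f (j a) = j a := fD _ (Dj a).
have f_iota a : f (iota a) = iota a.
  have : K (iota a) by apply: iK.2; exists a.
  by rewrite E => -[b _ <-].
exists (Autk fb f_iota); first by move=> z; rewrite E => -[a _ <-]; apply: fj.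
have : D (x, y) by exists 'X; rewrite // map_polyX !hornerX.
by move/fD.
Qed.

Lemma autkK (g : G) : cancel g (g^-1%g : G).
Proof. by move=> x; rewrite -autkME mulVg. Qed.
Lemma autkVK (g : G) : cancel (g^-1%g : G) g.
Proof. by move=> x; rewrite -autkME mulgV. Qed.

Lemma nbhs_agree (s : G) (X : set F) : finite_set X ->
  nbhs s [set g : G | forall x, X x -> g x = s x].
Proof.
move=> fX; exists X => //; rewrite fixing_adjoin => _ [u uX <-] x Xx.
by rewrite autkME uX.
Qed.

(** The topology is that of pointwise convergence for discrete [F]: basic neighbourhoods prescribe
    finitely many values. *)
Lemma autk_cvg (U : set_system G) (s : G) : Filter U ->
  (forall x, U [set g : G | g x = s x]) -> U --> s.
Proof.
move=> FU Us A [X fX]; rewrite fixing_adjoin => sA.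
suff UX : U [set g : G | forall x, X x -> g x = s x].
  apply: filterS UX => g gX; apply: sA; exists (s^-1 * g)%g; last by rewrite mulgA mulgV mul1g.
  by move=> x Xx; rewrite autkME gX // autkK.
move/finite_seqP : fX => [r ->].
elim: r => [|x r IHr]; first by apply: filterS filterT => g _ x.
apply: filterS (filterI (Us x) IHr) => g [gx gr] y /=; rewrite inE => /predU1P[->//|]; exact: gr.
Qed.

(* An ultrafilter on the Galois group picks out one conjugate of each element,
   since there are finitely many. *)
Lemma compact_fixing K : ifield K -> (forall x, algebraic_over K x) ->
  compact (fixing K : set G).
Proof.
move=> iK algK; rewrite compact_ultra => U UU UK.
have pick (f : G -> F) (p : {poly F}) : p != 0 -> U [set g | root p (f g)] ->
    exists y, U [set g | f g = y].
  have [r ->] := closed_field_poly_normal p; rewrite scaler_eq0 lead_coef_eq0 => /norP[l0 _].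
  move=> Ur; have {}Ur : U [set g | f g \in r].
    apply: filterS Ur => g /=; rewrite rootZ ?root_prod_XsubC //.
    by rewrite lead_coef_eq0.
  apply: contrapT => /forallNP nU.
  suff : U set0 by apply: filter_not_empty.
  elim: r Ur {l0} => [|y r IHr] Ur; first by apply: filterS Ur.
  apply: IHr; have := in_ultra_setVsetC [set g | f g = y] UU => -[/nU//|Uy].
  by apply: filterS (filterI Ur Uy) => g [/= + ny]; rewrite inE => /predU1P[].
have /choice[s Us] x : exists y, U [set g : G | g x = y].
  have [p [p0 pK px]] := algK x; apply: (pick (fun g => g x) p p0).
  apply: filterS UK => g gK /=; rewrite rootE -[X in X.[_]](_ : map_poly g p = p).
    by rewrite horner_map (rootP px) rmorph0.
  by apply/polyP => i; rewrite coef_map /= gK.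
(* The pointwise limit of the inverses is taken as well, to make the limit [s] bijective. *)
have /choice[t Ut] x : exists y, U [set g : G | (g^-1%g : G) x = y].
  have [p [p0 pK px]] := algK x; apply: (pick (fun g => (g^-1%g : G) x) p p0).
  apply: filterS UK => g gK /=; rewrite rootE -[X in X.[_]](_ : map_poly (g^-1%g : G) p = p).
    by rewrite horner_map (rootP px) rmorph0.
  by apply/polyP => i; rewrite coef_map /= (fixingV gK).
have st : cancel s t.
  move=> x; have [g [/= gs gt]] := filter_ex (filterI (Us x) (Ut (s x))).
  by rewrite -gt -gs autkK.
have ts : cancel t s.
  move=> x; have [g [/= gt gs]] := filter_ex (filterI (Ut x) (Us (t x))).
  by rewrite -gs -gt autkVK.
have sB : zmod_morphism s.
  move=> x y; have [g [[/= gx gy] gxy]] := filter_ex (filterI (filterI (Us x) (Us y)) (Us (x - y))).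
  by rewrite -gxy rmorphB gx gy.
have sM : monoid_morphism s.
  split; first by have [g /= <-] := filter_ex (Us 1); rewrite rmorph1.
  move=> x y; have [g [[/= gx gy] gxy]] := filter_ex (filterI (filterI (Us x) (Us y)) (Us (x * y))).
  by rewrite -gxy rmorphM gx gy.
pose sB' := GRing.isZmodMorphism.Build F F s sB.
pose sM' := GRing.isMonoidMorphism.Build F F s sM.
pose sR : {rmorphism F -> F} := HB.pack s sB' sM'.
have sb : bijective sR by exists t.
have s_iota a : sR (iota a) = iota a.
  by have [g /= <-] := filter_ex (Us (iota a)); rewrite autk_fix.
exists (Autk sb s_iota); split.
  move=> x Kx; have [g [/= gK gx]] := filter_ex (filterI UK (Us x)).
  by rewrite -gx gK.
exact: autk_cvg.
Qed.

Lemma Gcirc_group : subgroup Gc.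
Proof.
rewrite /subgroup; have E (x : G) : (x \in Gc) <-> Gc x by split=> [/set_mem|/mem_set].
split=> [|x y /E Gx /E Gy]; apply/E.
  by move=> X [[X1 _] _]; exact: set_mem.
move=> X hX; have [[_ XD] _] := hX; apply: set_mem.
by apply: XD; apply: mem_set; [exact: Gx|exact: Gy].
Qed.

Lemma Gcirc1 : Gc 1%g. Proof. by case: Gcirc_group => /set_mem. Qed.
Lemma GcircM g h : Gc g -> Gc h -> Gc (g * h)%g.
Proof.
move=> Gg Gh; apply: set_mem; apply: (group_closedM Gcirc_group); exact: mem_set.
Qed.
Lemma GcircV g : Gc g -> Gc g^-1%g.
Proof. by move=> Gg; apply: set_mem; apply: (group_closedV Gcirc_group); exact: mem_set. Qed.

Lemma fixing_Gcirc K : ifield K -> (forall x, algebraic_over K x) -> fixing K `<=` Gc.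
Proof.
move=> iK algK g gK X [_]; apply; exists (fixing K : set G) => //.
split; last exact: compact_fixing.
split; first by apply: mem_set; exact: fixing1.
move=> x y /set_mem xK /set_mem yK; apply: mem_set; apply: fixingM => //; exact: fixingV.
Qed.

(* A maximal extension of [K] meeting the algebraic closure of [K] in [K] only
   has [F] algebraic over it, and [x], [y] are still conjugate over it. *)
Lemma exists_Gcirc_conjugate K x y : ifield K -> algebraic_over K x -> conjugate K x y ->
  exists2 u : G, Gc u /\ fixing K u & u x = y.
Proof.
move=> iK ax cxy; pose aK := [set z | algebraic_over K z].
pose P L := L = set0 \/ [/\ ifield L, K `<=` L & forall z, L z -> aK z -> K z].
have [C CP Ct|L [PL maxL]] := @Zorn_bigcup _ P.
  have [[D1 [CD1 D1n]]|nC] := EM (exists D, C D /\ D !=set0); last first.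
    left; apply/seteqP; split=> // p [D CD Dp]; apply: nC; exists D; split=> //; by exists p.
  pose C' := [set D | C D /\ D !=set0].
  have C'P D : C' D -> [/\ ifield D, K `<=` D & forall z, D z -> aK z -> K z].
    by case=> /CP[->|//] [p []].
  have -> : \bigcup_(X in C) X = \bigcup_(X in C') X.
    apply/seteqP; split=> p [D CD Dp]; last by exists D => //; case: CD.
    by exists D => //; split=> //; exists p.
  have C'D1 : C' D1 by [].
  have two p q : (\bigcup_(D in C') D) p -> (\bigcup_(D in C') D) q ->
      exists D, [/\ C' D, D p & D q].
    move=> [A C'A Ap] [B C'B Bq].
    by have [s|s] := Ct _ _ C'A.1 C'B.1; [exists B|exists A]; split=> //; apply: s.
  right; split.
  - have E z : (z \in \bigcup_(D in C') D) <-> exists2 D, C' D & D z.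
      by split=> [/set_mem[D]|[D C'D Dz]]; [exists D|apply: mem_set; exists D].
    have Eb z : (exists2 D, C' D & D z) <-> (\bigcup_(D in C') D) z by split=> -[D]; exists D.
    split; last by move=> z rz; exists D1 => //; have [[_ sub] _ _] := C'P _ C'D1; exact: sub.
    split=> [|p q /E/Eb Dp /E/Eb Dq|p q /E/Eb Dp /E/Eb Dq]; apply/E.
    + by exists D1 => //; have [[[h _ _] _] _ _] := C'P _ C'D1; exact: set_mem h.
    + have [D [C'D Dp' Dq']] := two _ _ Dp Dq; exists D => //.
      by have [[[_ DB _] _ ] _ _] := C'P _ C'D; apply: set_mem; apply: DB; apply: mem_set.
    + have [D [C'D Dp' Dq']] := two _ _ Dp Dq; exists D => //.
      by have [[[_ _ DV] _ ] _ _] := C'P _ C'D; apply: set_mem; apply: DV; apply: mem_set.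
  - by move=> z Kz; exists D1 => //; have [_ sub _] := C'P _ C'D1; exact: sub.
  - by move=> z [D C'D Dz] az; have [_ _ sub] := C'P _ C'D; exact: sub.
have {PL}[iL KL LK] : [/\ ifield L, K `<=` L & forall z, L z -> aK z -> K z].
  case: PL => // LE; case: (maxL K); last by right; split.
  rewrite LE; split; first by [].
  by move=> /(_ 1); apply; case: iK => [[/set_mem ? _ _] _].
have algL z : algebraic_over L z.
  apply: contrapT => nz; have [M [j EL]] := ifield_type iL.
  have aL : adjoin L = L by apply: adjoin_id.
  case: (maxL (adjoin (z |` L))).
    split; first by move=> w Lw; apply: sub_adjoin; right.
    move=> sub; apply: nz; apply: (@algebraic_over_mem _ _ iota) => //; apply: sub.
    by apply: sub_adjoin; left.
  right; split; first exact: adjoin_field.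
    by move=> w Kw; apply: sub_adjoin; right; apply: KL.
  move=> w Lzw aw; apply: LK => //; rewrite -aL.
  apply: (@adjoin1_algebraic _ _ _ _ j L z) => //; rewrite ?aL //.
    by rewrite /algebraic_closure /= aL.
  by rewrite /algebraic_closure /= aL; apply: algebraic_over_sub aw.
have [L' [j EL]] := ifield_type iL.
(* The minimal polynomial of [x] over [L] has roots algebraic over [K], hence coefficients in [L]
   that are algebraic over [K]; these lie in [K], so that [y] is a root of it. *)
have cL : conjugate L x y.
  have [p [mp irr rp]] : exists p : {poly L'}, [/\ p \is monic, irreducible_poly p &
      forall q, root (map_poly j q) x = (p %| q)].
    by apply: algebraic_minpoly; apply/algebraic_overP; rewrite -EL; apply: algebraic_over_sub ax.
  have [r Er] := closed_field_poly_normal (map_poly j p).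
  rewrite lead_coef_map (monicP mp) rmorph1 scale1r in Er.
  have [p0 [p00 p0K p0x]] := ax.
  have [q0 Eq0] : exists q, p0 = map_poly j q.
    by apply: poly_range => i; rewrite -EL; apply: KL.
  have aKf : ifield aK by apply: algebraic_over_ifield.
  have [M [m EM]] := ifield_type aKf.
  have [|q1 Eq1] := @prod_XsubC_range _ _ m r.
    move=> z zr; rewrite -EM; exists p0; split=> //; rewrite Eq0.
    have : p %| q0 by rewrite -rp -Eq0.
    by move=> /dvdpP[w ->]; rewrite rmorphM rootM /= Er root_prod_XsubC zr orbT.
  have pK i : K (map_poly j p)`_i.
    apply: LK; first by rewrite coef_map EL; exists p`_i.
    by rewrite EM Er Eq1 coef_map; exists q1`_i.
  move=> q qL qx.
  have [q2 Eq2] : exists q', q = map_poly j q'.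
    by apply: poly_range => i; rewrite -EL; apply: qL.
  move: qx; rewrite Eq2 rp => /dvdpP[w ->]; rewrite rmorphM rootM /= (cxy _ pK) ?orbT //.
  by rewrite rp.
have [u uL ux] := exists_automorphism iL algL cL.
exists u => //; split; first exact: fixing_Gcirc uL.
by move=> z Kz; apply: uL; apply: KL.
Qed.

Hypothesis char0 : [pchar F] =i pred0.

(** Galois descent with automorphisms taken in [Gcirc]. In characteristic 0 the minimal polynomial
    of [x] is separable, and it has degree at least 2, so some conjugate differs from [x]. *)
Lemma exists_Gcirc_moving K x : ifield K -> algebraic_over K x -> ~ K x ->
  exists2 u : G, Gc u /\ fixing K u & u x <> x.
Proof.
move=> iK ax nKx; have [L [j E]] := ifield_type iK.
have [p [mp irr rp]] : exists p : {poly L}, [/\ p \is monic, irreducible_poly p &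
    forall q, root (map_poly j q) x = (p %| q)].
  by apply: algebraic_minpoly; apply/algebraic_overP; rewrite -E.
have /factor_theorem[q Eq] : root (map_poly j p) x by rewrite rp.
have [sp _] := irr; have p0 := monic_neq0 mp.
have dpx : (map_poly j p)^`().[x] != 0.
  rewrite deriv_map -rootE rp; apply/negP => /dvdp_leq.
  have dp0 : p^`() != 0.
    have sdp : p^`()`_(size p).-2 != 0.
      rewrite coef_deriv -mulr_natr mulf_neq0 //.
        by rewrite (_ : (size p).-2.+1 = (size p).-1) ?lead_coef_eq0 //; case: (size p) sp => [|[]].
      by apply: pcharf0_natf_neq0; apply/(pchar0_rmorph j).
    by apply: contraNneq sdp => ->; rewrite coef0.
  by move=> /(_ dp0); rewrite leqNgt lt_size_deriv.
have qx : q.[x] != 0.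
  move: dpx; rewrite Eq derivM derivXsubC mulr1 hornerD hornerM hornerXsubC subrr.
  by rewrite mulr0 add0r.
have sq : size q != 1%N.
  apply/eqP => sq; have : size (map_poly j p) = 2.
    by rewrite Eq size_Mmonic ?monicXsubC -?size_poly_gt0 ?sq // size_XsubC.
  rewrite size_map_poly => sp2; apply: nKx.
  have : root (map_poly j p) x by rewrite rp.
  rewrite rootE (@horner_map_wide _ _ _ 2) ?sp2 // !big_ord_recl big_ord0 /= expr0 expr1.
  have -> : p`_1 = 1 by move/monicP: mp; rewrite /lead_coef sp2.
  rewrite rmorph1 mul1r mulr1 addr0 addrC addr_eq0 => /eqP ->.
  by rewrite E; exists (- p`_0); rewrite ?rmorphN.
have /closed_rootP[y qy] := sq.
have cxy : conjugate K x y.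
  move=> r rK rx; have [r' Er] : exists r', r = map_poly j r'.
    by apply: poly_range => i; rewrite -E; apply: rK.
  move: rx; rewrite Er rp => /dvdpP[w ->]; rewrite rmorphM rootM /= Eq.
  by rewrite rootM qy orbT.
have [u uK ux] := exists_Gcirc_conjugate iK ax cxy.
exists u => //; rewrite ux => yx; move: qy; rewrite rootE yx; exact/negP.
Qed.
End Automorphisms.

(** * Transcendental elements, bases and finite extensions *)

Section Generators.
Variables (k F : closedFieldType) (iota : {rmorphism k -> F}).
Hypothesis char0 : [pchar F] =i pred0.
Implicit Types (A B K : set F) (x y : F).
Local Notation ifield := (intermediate_field iota).
Local Notation adjoin := (adjoin iota).
Local Notation acl := (algebraic_closure iota).
Local Notation G := (autk iota).
Local Notation Gc := (Gcirc G).

Lemma ifieldB K x y : ifield K -> K x -> K y -> K (x - y).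
Proof. by case=> [[_ KB _] _] Kx Ky; apply: set_mem; apply: KB; apply: mem_set. Qed.
Lemma ifield1 K : ifield K -> K 1. Proof. by case=> [[/set_mem]]. Qed.
Lemma ifield0 K : ifield K -> K 0.
Proof. by move=> iK; rewrite -(subrr 1); apply: ifieldB => //; apply: ifield1. Qed.
Lemma ifieldN K x : ifield K -> K x -> K (- x).
Proof. by move=> iK Kx; rewrite -sub0r; apply: ifieldB => //; apply: ifield0. Qed.
Lemma ifieldD K x y : ifield K -> K x -> K y -> K (x + y).
Proof. by move=> iK Kx Ky; rewrite -[y]opprK; apply: ifieldB => //; apply: ifieldN. Qed.
Lemma ifield_div K x y : ifield K -> K x -> K y -> K (x / y).
Proof. by case=> [[_ _ KV] _] Kx Ky; apply: set_mem; apply: KV; apply: mem_set. Qed.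
Lemma ifieldV K x : ifield K -> K x -> K x^-1.
Proof. by move=> iK Kx; rewrite -div1r; apply: ifield_div => //; apply: ifield1. Qed.
Lemma ifieldM K x y : ifield K -> K x -> K y -> K (x * y).
Proof. by move=> iK Kx Ky; rewrite -[y]invrK; apply: ifield_div => //; apply: ifieldV. Qed.
Lemma ifieldX K x n : ifield K -> K x -> K (x ^+ n).
Proof.
by move=> iK Kx; elim: n => [|n IHn]; rewrite ?expr0 ?exprS; [exact: ifield1|exact: ifieldM].
Qed.
Lemma ifield_horner K (p : {poly F}) x : ifield K -> (forall i, K p`_i) -> K x -> K p.[x].
Proof.
move=> iK pK Kx; rewrite horner_coef; elim/big_ind: _ => [|a b|i _].
- exact: ifield0.
- exact: ifieldD.
- by apply: ifieldM => //; apply: ifieldX.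
Qed.
Lemma ifield_iota K a : ifield K -> K (iota a).
Proof. by case=> _; apply; exists a. Qed.
Lemma ifield_nat K n : ifield K -> K n%:R.
Proof. by move=> iK; rewrite -(rmorph_nat iota); apply: ifield_iota. Qed.

Lemma acl0 : acl set0 = range iota.
Proof.
have i0 : ifield (range iota) by apply: ifield_range.
have a0 : adjoin set0 = range iota.
  apply/seteqP; split; first exact: adjoin_min.
  by move=> _ [a _ <-]; apply: ifield_iota; apply: adjoin_field.
apply/seteqP; split=> [x|x rx]; last by apply: adjoin_sub_acl; rewrite a0.
rewrite /algebraic_closure /= a0 => /algebraic_overP[p p0].
have [r ->] := closed_field_poly_normal p.
have := p0; rewrite -lead_coef_eq0 => l0.
rewrite map_polyZ rootZ ?fmorph_eq0 // rmorph_prod /=.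
under eq_bigr do rewrite rmorphB /= map_polyX map_polyC /=.
rewrite -(big_map iota predT (fun z => 'X - z%:P)) root_prod_XsubC => /mapP[a _ ->].
by exists a.
Qed.

Lemma autk_adjoin (g : G) A B : (forall x, A x -> adjoin B (g x)) ->
  forall x, adjoin A x -> adjoin B (g x).
Proof.
move=> gA; apply: (@adjoin_min _ _ iota A [set x | adjoin B (g x)]) => //.
have iB := adjoin_field iota B.
have E y : (y \in [set x | adjoin B (g x)]) <-> adjoin B (g y) by split=> [/set_mem|/mem_set].
split; last by move=> _ [a _ <-] /=; rewrite autk_fix; apply: ifield_iota.
split=> [|y z /E gy /E gz|y z /E gy /E gz]; apply/E.
- by rewrite rmorph1; apply: ifield1 iB.
- by rewrite rmorphB; apply: ifieldB iB gy gz.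
- by rewrite fmorph_div; apply: ifield_div iB gy gz.
Qed.

Lemma autk_acl (g : G) A B : (forall x, A x -> acl B (g x)) ->
  forall x, acl A x -> acl B (g x).
Proof.
move=> gA x [p [p0 pA px]]; apply: algebraic_over_acl; exists (map_poly g p); split.
- by rewrite map_poly_eq0.
- move=> i; rewrite coef_map /=; have iB := acl_field iota B.
  rewrite -(adjoin_id iB); apply: autk_adjoin (pA i) => y Ay.
  by apply: sub_adjoin; apply: gA.
- by rewrite fmorph_root.
Qed.

Lemma aclU1 A x : acl (x |` A) = acl (x |` acl A).
Proof.
apply/seteqP; split; first by apply: acl_sub => y [->|Ay]; [left|right; apply: sub_acl].
apply: acl_min => y [->|Ay]; first by apply: sub_acl; left.
by apply: acl_sub Ay => z; right.
Qed.

Lemma simple_extension (L : fieldType) (j : {rmorphism L -> F}) x :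
    ifield (range j) -> ~ algebraic_over (range j) x ->
  ~ algebraicOver j x /\ exists (M : fieldType) (m : {rmorphism M -> F}),
    adjoin (x |` range j) = range m /\
    forall z, (exists b, z = m b) <-> exists p q, evalX j x q != 0 /\ z = evalX j x p / evalX j x q.
Proof.
move=> iK nx; split; first by move/algebraic_overP.
have [M [m EM]] := ifield_type (adjoin_field iota (x |` range j)).
exists M, m; split=> // z; have H := adjoin1_frac x (adjoin_id iK) z.
by rewrite EM in H; split=> [[b Eb]|/H[b _ <-]]; [apply/H; rewrite Eb; exists b|exists b].
Qed.

(* A relation [P(x, y) = 0] over [acl A] that is nontrivial in [y] is
   nontrivial in [x], as [y] is transcendental. *)
Lemma acl_exchange A x y : acl (x |` A) y -> ~ acl A y -> acl (y |` A) x.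
Proof.
rewrite [acl (x |` A)]aclU1 [acl (y |` A)]aclU1; have := acl_field iota A.
have nalg z : ~ acl A z -> ~ algebraic_over (acl A) z by move=> nz /algebraic_over_acl.
set K := acl A in nalg * => iK + ny.
have [Kx _|nx] := EM (K x); first by apply: sub_acl; right.
have [L [j E]] := ifield_type iK; rewrite E in iK nalg nx ny *.
have [xtr [M [m [EM rM]]]] := simple_extension iK (nalg _ nx).
have [ytr [N [n [EN rN]]]] := simple_extension iK (nalg _ ny).
rewrite {1}/algebraic_closure /= EM => /algebraic_overP /(algXP xtr rM)[P P0 /rootP Py].
rewrite /algebraic_closure /= EN; apply/algebraic_overP; apply/(algXP ytr rN).
exists (swapXY P); first by rewrite swapXY_eq0.
apply/rootP; rewrite -[RHS]Py; elim/poly_ind: P {P0 Py} => [|P c IHP].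
  by rewrite !rmorph0 !horner0.
rewrite rmorphD rmorphM /= swapXY_X swapXY_polyC !rmorphD !rmorphM /=.
rewrite !map_polyX !map_polyC /= !hornerE IHP evalX_X; congr (_ + _).
by rewrite -map_poly_comp evalXE; congr (_.[_]); apply: eq_map_poly => a /=; rewrite evalXC.
Qed.

(** [z = y - c] is quadratic over the field [B] generated by [z ^+ 2] over [acl A], so [z -> - z]
    extends to an element of [Gcirc] by [exists_Gcirc_conjugate]. *)
Lemma exists_reflection A y c : ~ acl A y -> acl A c ->
  exists2 u : G, Gc u /\ fixing (acl A) u & u y = c *+ 2 - y.
Proof.
move=> ny Ac; pose z := y - c; have iK := acl_field iota A.
have nz : ~ acl A z.
  by move=> Az; apply: ny; rewrite -(subrK c y); apply: (ifieldD iK Az Ac).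
have nza : ~ algebraic_over (acl A) z by move/algebraic_over_acl.
pose B := adjoin (z ^+ 2 |` acl A); have iB : ifield B := adjoin_field iota _.
have Bz2 : B (z ^+ 2) by apply: sub_adjoin; left.
have BA x : acl A x -> B x by move=> Ax; apply: sub_adjoin; right.
have nBz : ~ B z.
  have [L [j E]] := ifield_type iK; rewrite E in iK nza.
  have [ztr _] := simple_extension iK nza.
  have aj : adjoin (acl A) = range j by rewrite adjoin_id // E.
  move=> /(adjoin1_frac _ aj)[p [q [q0 Ez]]].
  have : evalX j z ((q \Po 'X^2) * 'X - (p \Po 'X^2)) == 0.
    rewrite rmorphB rmorphM /= evalX_X !evalXE !map_comp_poly !horner_comp map_polyXn hornerXn.
    by rewrite -!evalXE {2}Ez mulrC divfK // subrr.
  rewrite evalX_eq0 // subr_eq0 => /eqP Epq.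
  have q0' : q != 0 by apply: contraNneq q0 => ->; rewrite rmorph0.
  have q20 : q \Po 'X^2 != 0 by rewrite comp_poly_eq0 ?size_polyXn.
  have p20 : p \Po 'X^2 != 0 by rewrite -Epq mulf_neq0 ?polyX_eq0.
  (* The degree of the left side is odd and that of the right side is even. *)
  have := congr1 (fun r : {poly L} => (size r).-1) Epq.
  rewrite size_mulX //= size_comp_poly size_polyXn -(prednK (n := size _)) ?size_poly_gt0 //.
  by rewrite size_comp_poly size_polyXn /= !muln2 => /(congr1 odd); rewrite /= !odd_double.
have az : algebraic_over B z.
  exists ('X^2 - (z ^+ 2)%:P); split.
  - by rewrite -size_poly_eq0 size_XnsubC.
  - move=> i; rewrite coefB coefXn coefC; apply: (ifieldB iB).
      by exact: (ifield_nat _ iB).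
    by case: ifP => _ //; exact: (ifield0 iB).
  - by rewrite rootE !hornerE subrr.
(* Writing the value of [p] at [z] as [e + o * z] with [e], [o] in [B], a zero forces [o = 0], for
   otherwise [z] would be in [B]. *)
have cz : conjugate B z (- z).
  move=> p pB; rewrite -{1 2}(poly_even_odd p) !rootE !hornerE !horner_comp !hornerE sqrrN.
  set e := (even_poly p).[_]; set o := (odd_poly p).[_].
  have Be : B e by apply: (ifield_horner iB) => // i; rewrite coef_even_poly.
  have Bo : B o by apply: (ifield_horner iB) => // i; rewrite coef_odd_poly.
  have [-> |o0] := eqVneq o 0; first by rewrite !mul0r.
  rewrite addrC addr_eq0 => /eqP Ez; case: nBz.
  have -> : z = (- e) / o by rewrite -Ez mulrAC mulfV // mul1r.
  by apply: (ifield_div iB _ Bo); exact: (ifieldN iB Be).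
have [u [Gu uB] uz] := exists_Gcirc_conjugate iB az cz.
exists u; first by split=> // x /BA; apply: uB.
by rewrite -{1}[y](subrK c) -/z rmorphD uz (uB _ (BA _ Ac)) /z; ring.
Qed.

(** A nontrivial translation has infinite order on [y], so it is not obtained from a conjugation of
    [y] over a subfield. It is the product of two reflections, about 0 and about [- c / 2]. *)
Lemma exists_translation A y c : ~ acl A y -> acl A c ->
  exists2 v : G, Gc v /\ fixing (acl A) v & v y = y + c.
Proof.
move=> ny Ac; have iK := acl_field iota A.
have A0 : acl A 0 by apply: (ifield0 iK).
have A2 : acl A (- (c / 2%:R)).
  by apply: (ifieldN iK); apply: (ifield_div iK Ac); apply: (ifield_nat _ iK).
have [u [Gu uA] uy] := exists_reflection ny A0; have [v [Gv vA] vy] := exists_reflection ny A2.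
exists (v * u)%g; first by split; [exact: GcircM|exact: fixingM].
rewrite autkME uy mul0rn sub0r rmorphN vy opprB mulNrn opprK; congr (_ + _).
by rewrite -[_ *+ 2]mulr_natr divfK //; apply: (pcharf0_natf_neq0 1 char0).
Qed.

End Generators.

(** * Transcendence bases, primitive elements and degrees *)

Section FiniteExtensions.
Variables (k F : closedFieldType) (iota : {rmorphism k -> F}).
Hypothesis char0 : [pchar F] =i pred0.
Implicit Types (A B K Y S : set F) (x y : F).
Local Notation ifield := (intermediate_field iota).
Local Notation adjoin := (adjoin iota).
Local Notation acl := (algebraic_closure iota).

(** Algebraic independence over [k] in terms of the closure operator, to which the exchange property
    applies directly, without polynomials in several variables. *)
Definition acl_independent Y := forall y, Y y -> ~ acl (Y `\ y) y.
Local Notation independent := acl_independent.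

Lemma independent_sub Y Y' : Y' `<=` Y -> independent Y -> independent Y'.
Proof.
move=> sY iY y Yy ay; apply: (iY y (sY _ Yy)); apply: acl_sub ay.
by move=> z [Yz zy]; split=> //; apply: sY.
Qed.

Lemma independentU1 Y x : independent Y -> ~ acl Y x -> independent (x |` Y).
Proof.
move=> iY nx y [->|Yy] ay.
  by apply: nx; apply: acl_sub ay => z [[->|//] zx]; case: zx.
have [yx|yx] := eqVneq y x; first by apply: nx; apply: sub_acl; rewrite -yx.
have {ay} : acl (x |` (Y `\ y)) y by apply: acl_sub ay => z [[->|Yz] zy]; [left|right].
move=> /acl_exchange /(_ (iY y Yy)) ax; apply: nx; apply: acl_sub ax.
by move=> z [->|[]].
Qed.

Lemma exists_basis Y0 S : finite_set Y0 -> independent Y0 -> finite_set S ->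
  exists Y, [/\ finite_set Y, independent Y, Y0 `<=` Y, Y `<=` Y0 `|` S & S `<=` acl Y].
Proof.
move=> fY0 iY0 /finite_seqP[r ->]; elim: r => [|x r [Y [fY iY Y0Y YS SY]]].
  by exists Y0; split=> // y; left.
have [ax|nx] := EM (acl Y x).
  exists Y; split=> //.
    by move=> y /YS[|/=] Yy; [left|right; rewrite inE Yy orbT].
  by move=> y /=; rewrite inE => /predU1P[->//|yr]; apply: SY.
exists (x |` Y); split.
- by rewrite finite_setU.
- exact: independentU1.
- by move=> y /Y0Y; right.
- by move=> y [->|/YS[|/=] Yy]; [right; rewrite /= mem_head|left|right; rewrite /= inE Yy orbT].
- move=> y /=; rewrite inE => /predU1P[->|yr]; first by apply: sub_acl; left.
  by apply: acl_sub (SY y yr) => z; right.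
Qed.

Lemma adjoin1_poly (L : fieldType) (j : {rmorphism L -> F}) A x y : adjoin A = range j ->
  acl A x -> adjoin (x |` A) y -> exists p, y = (map_poly j p).[x].
Proof.
move=> E ax /(adjoin1_frac x E)[p [q [q0 ->]]].
have [mu [mmu irr rmu]] : exists p : {poly L}, [/\ p \is monic, irreducible_poly p &
    forall q, root (map_poly j q) x = (p %| q)].
  by apply: algebraic_minpoly; apply/algebraic_overP; rewrite -E.
have : ~~ (mu %| q) by rewrite -rmu.
rewrite -irreducible_poly_coprime // => /Bezout_eq1_coprimepP[[u v] /= Euv].
exists (p * v); rewrite rmorphM hornerM /= -evalXE; congr (_ * _).
have mux : (map_poly j mu).[x] = 0 by apply/rootP; rewrite rmu.
have := congr1 (fun r => (map_poly j r).[x]) Euv.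
rewrite /= rmorphD !rmorphM /= hornerD !hornerM mux mulr0 add0r rmorph1 hornerC => vq.
by rewrite -[RHS](mulfK q0) evalXE vq mul1r.
Qed.

Lemma primitive_element A S : finite_set S -> S `<=` acl A ->
  exists th, acl A th /\ S `<=` adjoin (th |` A).
Proof.
move=> /finite_seqP[r ->]; elim: r => [|x r IHr] sA.
  exists 0; split=> //; exact: ifield0 (acl_field _ _).
have [|th [ath sth]] := IHr; first by move=> y yr; apply: sA; rewrite /= inE yr orbT.
have [L [j E]] := ifield_type (adjoin_field iota A).
have algj y : acl A y -> algebraicOver j y by rewrite /algebraic_closure /= E => /algebraic_overP.
have ax : acl A x by apply: sA; rewrite /= mem_head.
have [p p0 px] := algj x ax; have [q q0 qth] := algj th ath.
have c0L : [pchar L] =i pred0 by apply/(pchar0_rmorph j).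
have [n [[u Eu] [v Ev]]] := pchar0_PET p0 px q0 qth c0L.
set z := (X in (map_poly j u).[X]) in Eu Ev.
have zpoly w : adjoin (z |` A) (map_poly j w).[z].
  apply: ifield_horner (adjoin_field _ _) _ _ => [i|]; last by apply: sub_adjoin; left.
  rewrite coef_map /=; apply: (@adjoinS _ _ iota A) => [y|]; first by right.
  by rewrite E; exists w`_i.
have adj w : w = x \/ w = th -> adjoin (z |` A) w.
  by case=> ->; [rewrite -Eu|rewrite -Ev]; apply: zpoly.
exists z; split.
  rewrite /z; apply: (ifieldB (acl_field iota A)) => //.
  rewrite -mulr_natr; apply: (ifieldM (acl_field iota A)) => //.
  exact: (ifield_nat _ (acl_field iota A)).
move=> y /=; rewrite inE => /predU1P[->|yr]; first by apply: adj; left.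
have := sth y yr; apply: adjoin_min; first exact: adjoin_field.
by move=> w [->|Aw]; [apply: adj; right|apply: sub_adjoin; right].
Qed.

(** The powers of [y] of exponent 0 to [n] are represented modulo [mu] in a space of dimension [n],
    the degree of [mu]. *)
Lemma degree_bound (L : fieldType) (j : {rmorphism L -> F}) A th : adjoin A = range j ->
  acl A th -> exists n, forall y, adjoin (th |` A) y ->
    exists p : {poly L}, [/\ p != 0, (size p <= n.+1)%N & root (map_poly j p) y].
Proof.
move=> E ath.
have [mu [mmu irr rmu]] : exists p : {poly L}, [/\ p \is monic, irreducible_poly p &
    forall q, root (map_poly j q) th = (p %| q)].
  by apply: algebraic_minpoly; apply/algebraic_overP; rewrite -E.
pose n := (size mu).-1; exists n => y /(adjoin1_poly E ath)[q ->].
pose B := \matrix_(i < n.+1) (poly_rV (q ^+ i %% mu) : 'rV_n).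
have [v v0 vB] := left_kernel B (ltnSn n).
exists (rVpoly v); split.
- by apply: contraNneq v0 => v0; rewrite -[v]rVpolyK v0 linear0.
- exact: size_poly.
have smu : size mu = n.+1 by rewrite /n prednK // size_poly_gt0 monic_neq0.
have E0 : \sum_(i < n.+1) v 0 i *: (q ^+ i %% mu) = 0.
  transitivity (rVpoly (v *m B)); last by rewrite vB linear0.
  rewrite mulmx_sum_row linear_sum; apply: eq_bigr => i _.
  have si : (size (q ^+ i %% mu)%R <= n)%N.
    by rewrite -ltnS (leq_trans _ (eq_leq smu)) // ltn_modp monic_neq0.
  by rewrite linearZ /= rowK poly_rV_K.
apply/rootP; rewrite (@horner_map_wide _ _ _ n.+1) ?size_poly //.
transitivity (map_poly j (\sum_(i < n.+1) v 0 i *: (q ^+ i %% mu))).[th]; last first.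
  by rewrite E0 rmorph0 horner0.
rewrite rmorph_sum horner_sum; apply: eq_bigr => i _ /=.
rewrite map_polyZ hornerZ coef_rVpoly_ord; congr (_ * _).
rewrite -horner_exp -rmorphXn /= {1}(divp_eq (q ^+ i) mu) rmorphD rmorphM /= hornerD hornerM.
have /rootP -> : root (map_poly j mu) th by rewrite rmu.
by rewrite mulr0 add0r.
Qed.

(** The exponents [a * m + i] with [i < m] are pairwise distinct, so nothing cancels in the sum. *)
Lemma power_independent (L : fieldType) (j : {rmorphism L -> F}) x m (p : nat -> {poly L}) :
  ~ algebraicOver j x -> \sum_(i < m) evalX j (x ^+ m) (p i) * x ^+ i = 0 ->
  forall i, (i < m)%N -> p i = 0.
Proof.
move=> xtr E i im; have m0 : (0 < m)%N by apply: leq_ltn_trans im.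
have : evalX j x (\sum_(i < m) (p i \Po 'X^m) * 'X^i) == 0.
  rewrite -[X in _ == X]E rmorph_sum; apply/eqP; apply: eq_bigr => l _.
  rewrite rmorphM rmorphXn /= evalX_X !evalXE map_comp_poly horner_comp.
  by rewrite map_polyXn hornerXn.
rewrite evalX_eq0 // => /eqP E0; apply/polyP => a; rewrite coef0.
have := congr1 (fun r : {poly L} => r`_(a * m + i)) E0.
rewrite coef0 coef_sum (bigD1 (Ordinal im)) //= big1 ?addr0 => [|l li].
  rewrite coefMXn ltnNge leq_addl /= addnK coef_comp_poly_Xn // dvdn_mull //.
  by rewrite mulnK.
rewrite coefMXn; case: ltnP => // ll; rewrite coef_comp_poly_Xn //.
case: ifP => // /dvdnP[b Eb]; case/eqP: li; apply/val_inj => /=.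
have := congr1 (modn^~ m) (subnK ll); rewrite /= Eb !modnMDl.
by rewrite !modn_small.
Qed.

(* With [x] part of a transcendence basis of [k(S)], an [m]-th root of [x]
   generates an extension of degree [m], whereas [k(S)] has bounded degree. *)
Lemma not_divisible S x : finite_set S -> adjoin S x -> ~ range iota x ->
  exists2 m, (0 < m)%N & forall y, adjoin S y -> y ^+ m <> x.
Proof.
move=> fS Sx nx.
have ix : independent [set x].
  by move=> y ->; rewrite setDv acl0.
have [Y [fY iY xY YS SY]] := exists_basis (finite_set1 x) ix fS.
have Yx : Y x by apply: xY.
pose A := Y `\ x; have nA : ~ acl A x := iY x Yx.
have YA : Y = x |` A by rewrite /A setD1K.
have iK := acl_field iota A.
have [L [j E]] := ifield_type iK.
have nj : ~ algebraic_over (range j) x by rewrite -E => /algebraic_over_acl.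
have iKj : ifield (range j) by rewrite -E.
have [xtr [M [m [EM rM]]]] := simple_extension iKj nj.
have SB : S `<=` acl (x |` range j).
  by move=> y /SY; rewrite YA aclU1 -E.
have [th [ath sth]] := primitive_element fS SB.
(* The exponent [n.+1] exceeds the degree bound [n]: a root [y] would satisfy a relation of degree
   at most [n] with coefficients that are rational functions of [y ^+ n.+1]. *)
have [n dn] := degree_bound EM ath; exists n.+1 => // y Sy yx.
have [|p [p0 sp py]] := dn y; first by apply: adjoin_min Sy => //; apply: adjoin_field.
have [d d0 [P EP]] := clear_denominators rM p.
have ytr : ~ algebraicOver j y.
  move=> /integral_algebraic iy; apply: xtr; apply/integral_algebraic; rewrite -yx.
  elim: n.+1 => [|l IHl]; rewrite ?expr0 ?exprS; first exact: integral1.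
  exact: integral_mul.
have P0 : P = 0.
  apply/polyP => i; rewrite coef0; have [ni|ni] := ltnP i n.+1; last first.
    have := congr1 (fun r : {poly F} => r`_i) EP.
    rewrite coef_map coefZ coef_map /= [p`_i]nth_default ?(leq_trans sp) // rmorph0 mulr0.
    by move/eqP; rewrite evalX_eq0 // => /eqP.
  apply: (@power_independent _ j y n.+1 (fun i => P`_i)) => //.
  transitivity (map_poly (evalX j x) P).[y].
    rewrite (@horner_coef_wide _ n.+1).
      by rewrite yx; apply: eq_bigr => l _; rewrite coef_map.
    by rewrite EP (leq_trans (size_scale_leq _ _)) ?size_map_poly.
  by rewrite EP hornerZ (rootP py) mulr0.
move: EP; rewrite P0 rmorph0 => /esym/eqP; rewrite scaler_eq0 (negPf d0) map_poly_eq0.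
exact/negP.
Qed.

End FiniteExtensions.

(** * Normal subgroups and their fixed fields *)

Section NormalSubgroups.
Variables (k F : closedFieldType) (iota : {rmorphism k -> F}).
Hypothesis char0 : [pchar F] =i pred0.
Implicit Types (A B K Y S : set F) (x y : F).
Local Notation ifield := (intermediate_field iota).
Local Notation adjoin := (adjoin iota).
Local Notation acl := (algebraic_closure iota).
Local Notation G := (autk iota).
Local Notation Gc := (Gcirc G).
Local Notation independent := (acl_independent iota).

(** Newton interpolation: dividing by [X - w] leaves a polynomial whose values at the other points
    are difference quotients, hence in [K]. *)
Lemma interpolation_ifield K (p : {poly F}) (ws : seq F) : ifield K -> uniq ws ->
  (size p <= size ws)%N -> {in ws, forall w, K w /\ K p.[w]} -> forall i, K p`_i.
Proof.
move=> iK; elim: ws p => [|w ws IHws] p /=.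
  by rewrite size_poly_leq0 => _ /eqP-> _ i; rewrite coef0; apply: ifield0 iK.
move=> /andP[nw uws] sp Kp i; have [Kw Kpw] := Kp w (mem_head _ _).
have /factor_theorem[r Er] : root (p - p.[w]%:P) w by rewrite rootE !hornerE subrr.
have Kr l : K r`_l.
  apply: IHws l => // [|z zr].
    have [->|r0] := eqVneq r 0; first by rewrite size_poly0.
    have : (size (r * ('X - w%:P))%R <= (size ws).+1)%N.
      rewrite -Er (leq_trans (size_polyD _ _)) // geq_max sp size_polyN.
      by rewrite (leq_trans (size_polyC_leq1 _)).
    by rewrite size_Mmonic ?monicXsubC // size_XsubC addn2.
  have [Kz Kpz] : K z /\ K p.[z] by apply: Kp; rewrite inE zr orbT.
  split=> //; have zw : z - w != 0 by rewrite subr_eq0; apply: contraNneq nw => <-.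
  have -> : r.[z] = (p.[z] - p.[w]) / (z - w).
    by rewrite -[LHS](mulfK zw) -hornerXsubC -hornerM -Er !hornerE.
  by apply: (ifield_div iK); apply: (ifieldB iK).
have -> : p = r * ('X - w%:P) + p.[w]%:P by rewrite -Er subrK.
rewrite coefD mulrBr coefB coefMX coefMC coefC; apply: (ifieldD iK).
  apply: (ifieldB iK); last exact: (ifieldM iK).
  by case: ifP => // _; apply: (ifield0 iK).
by case: ifP => // _; apply: (ifield0 iK).
Qed.

Lemma prod_XsubC_stable (h : {rmorphism F -> F}) (O : seq F) : uniq O ->
  {in O, forall z, h z \in O} ->
  map_poly h (\prod_(z <- O) ('X - z%:P)) = \prod_(z <- O) ('X - z%:P).
Proof.
move=> uO hO; rewrite rmorph_prod /=.
under eq_bigr do rewrite rmorphB /= map_polyX map_polyC /=.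
rewrite -(big_map h predT (fun z => 'X - z%:P)); apply: perm_big.
have uh : uniq (map h O) by rewrite map_inj_uniq //; apply: fmorph_inj.
have sh : {subset map h O <= O} by move=> _ /mapP[z zO ->]; apply: hO.
have [_ e] := uniq_min_size uh sh (eq_leq (esym (size_map h O))).
exact: uniq_perm.
Qed.

Lemma translation_polynomial (L : fieldType) (j : {rmorphism L -> F}) A y (h : G) th a :
    acl A = range j -> ~ acl A y -> fixing (acl A) h -> h y = y + 1 ->
    acl (y |` range j) th -> (forall s, adjoin (th |` (y |` range j)) (iter s h a)) ->
    integralOver (evalX j y) a ->
  exists p, a = evalX j y p.
Proof.
move=> E ny hA hy ath ha ia.
have iK : ifield (range j) by rewrite -E; apply: acl_field.
have nya : ~ algebraic_over (range j) y by rewrite -E => /algebraic_over_acl.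
have [ytr [M [m [EM rM]]]] := simple_extension iK nya.
have /choice[P EP] s : exists p, iter s h a = (map_poly m p).[th].
  exact: adjoin1_poly EM ath (ha s).
have c0 : [pchar L] =i pred0 by apply/(pchar0_rmorph j).
apply: (translation_integral_polynomial (h := h) c0 _ ytr _ hy rM _ _ EP ia).
- move=> b /algebraic_overP; rewrite -E => /algebraic_over_acl.
  by rewrite E => -[c _ <-]; exists c.
- by move=> b; apply: hA; rewrite E; exists b.
- move=> t /algebraic_overP; rewrite -EM => at_ ut.
  have iM := adjoin_field iota (y |` range j).
  have : adjoin (y |` range j) t.
    apply: contrapT => nt; have [u [_ uM]] := exists_Gcirc_moving char0 iM at_ nt.
    by apply; apply: ut => b; apply: uM; rewrite EM; exists b.
  by rewrite EM => -[b _ <-]; exists b.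
- by apply/algebraic_overP; rewrite -EM.
Qed.

(* By [translation_polynomial], an element of [M] integral over [acl A [y]] is a
   polynomial in [y]; its coefficients are recovered by interpolation from
   its translates, so they lie in [M] too, and one eliminates [y]. *)
Lemma stable_purity Y (M : set F) th : independent Y -> ifield M -> adjoin Y `<=` M ->
    acl Y th -> M `<=` adjoin (th |` Y) ->
    (forall y, Y y -> exists h : G,
       [/\ fixing (acl (Y `\ y)) h, h y = y + 1 & forall a, M a -> M (h a)]) ->
  forall r : seq F, [set` r] `<=` Y -> M `&` acl [set` r] `<=` adjoin [set` r].
Proof.
move=> iY iM YM ath Mth hY; elim=> [|y r IHr] rY a [Ma aa].
  rewrite set_nil acl0 in aa; case: aa => b _ <-.
  by apply: ifield_iota; apply: adjoin_field.
have Yy : Y y by apply: rY; rewrite /= mem_head.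
have rY' : [set` r] `<=` Y by move=> z /= zr; apply: rY; rewrite /= inE zr orbT.
set Z := [set` r] in IHr rY'.
have EZ : [set` y :: r] = y |` Z.
  apply/seteqP; split=> z /=; rewrite inE; first by case/predU1P; [left|right].
  by case=> [->|zr]; rewrite ?eqxx // [_ \in r]zr orbT.
rewrite EZ in aa *.
have [yr|yr] := boolP (y \in r).
  have yZ : y |` Z = Z by apply/seteqP; split=> [z [->//|//]|z]; right.
  by rewrite yZ in aa *; apply: IHr.
have ZY : Z `<=` Y `\ y.
  by move=> z Zz; split; [exact: rY'|move=> zy; move: yr; rewrite -zy (Zz : z \in r)].
have [h [hB hy hM]] := hY y Yy; have ny := iY y Yy.
have nyZ : ~ acl Z y by move/(acl_sub ZY).
have [L [j E]] := ifield_type (acl_field iota (Y `\ y)).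
have [L0 [j0 E0]] := ifield_type (adjoin_field iota Z).
have iZ : ifield (range j0) by rewrite -E0; apply: adjoin_field.
have nyZa : ~ algebraic_over (range j0) y by rewrite -E0.
have [ytr [M0 [m0 [EM0 rM0]]]] := simple_extension iZ nyZa.
have aZ0 : adjoin (y |` range j0) = adjoin (y |` Z).
  rewrite -E0; apply/seteqP; split; apply: adjoin_min; try exact: adjoin_field.
    move=> z [->|Zz]; first by apply: sub_adjoin; left.
    by apply: adjoinS Zz => w; right.
  move=> z [->|Zz]; first by apply: sub_adjoin; left.
  by apply: sub_adjoin; right; apply: sub_adjoin.
have [P P0 Pa] : algX j0 y a.
  by apply/(algXP ytr rM0)/algebraic_overP; rewrite -EM0 aZ0.
have [c c0 [Q mQ Qb]] := integral_scale ytr P0 Pa.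
set b := evalX j0 y c * a in Qb.
have ec0 : evalX j0 y c != 0 by rewrite evalX_eq0.
have ecZ : adjoin (y |` Z) (evalX j0 y c).
  have /rM0[d ->] : exists p q, evalX j0 y q != 0 /\ evalX j0 y c = evalX j0 y p / evalX j0 y q.
    by exists c, 1; rewrite rmorph1 oner_neq0 divr1.
  by rewrite -aZ0 EM0; exists d.
pose N := M `&` acl (y |` Z).
have iN : ifield N.
  have EN z : (z \in N) <-> M z /\ acl (y |` Z) z by split=> [/set_mem|/mem_set].
  have ia := acl_field iota (y |` Z).
  split; last by move=> _ [d _ <-]; split; apply: ifield_iota.
  split=> [|z w /EN[Mz az] /EN[Mw aw]|z w /EN[Mz az] /EN[Mw aw]]; apply/EN; split.
  - exact: ifield1 iM.
  - exact: ifield1 ia.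
  - exact: (ifieldB iM).
  - exact: (ifieldB ia).
  - exact: (ifield_div iM).
  - exact: (ifield_div ia).
have sZY : y |` Z `<=` Y by move=> z [->//|/ZY[]].
have Nsub : adjoin (y |` Z) `<=` N.
  by move=> z az; split; [apply: YM; apply: adjoinS az|apply: adjoin_sub_acl].
have Ny : N y by apply: Nsub; apply: sub_adjoin; left.
have Nb : N b by apply: (ifieldM iN); [exact: Nsub|split].
have Nh z : N z -> N (h z).
  move=> [Mz az]; split; first exact: hM.
  apply: autk_acl az => w [->|Zw]; last by rewrite hB; apply: sub_acl; [right|exact: ZY].
  rewrite hy; apply: (ifieldD (acl_field _ _)); first by apply: sub_acl; left.
  exact: ifield1 (acl_field _ _).
have Nhs s z : N z -> N (iter s h z) by move=> Nz; elim: s => //= s; apply: Nh.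
have thB : acl (y |` range j) th.
  by rewrite -E -aclU1; apply: acl_sub ath => z Yz; have [->|zy] := eqVneq z y;
    [left|right; split=> //; exact/eqP].
have hsb s : adjoin (th |` (y |` range j)) (iter s h b).
  have [Ms _] := Nhs s b Nb; apply: adjoinS (Mth _ Ms) => z [->|Yz]; first by left.
  right; have [->|zy] := eqVneq z y; first by left.
  by right; rewrite -E; apply: sub_acl; split=> //; exact/eqP.
have ib : integralOver (evalX j y) b.
  apply: (@integral_root_monic _ _ (evalX j y) _ (map_poly (evalX j0 y) Q)) => //.
    exact: monic_map.
  apply/integral_poly => i; rewrite coef_map /=.
  suff [q Eq] : exists q, map_poly j0 Q`_i = map_poly j q.
    by rewrite evalXE Eq -evalXE; apply: integral_id.
  apply: poly_range => l; rewrite -E; apply: (acl_sub ZY); apply: adjoin_sub_acl.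
  by rewrite E0 coef_map; exists (Q`_i)`_l.
have [p Ep] := translation_polynomial E ny hB hy thB hsb ib.
have hjy s : iter s h y = y + s%:R.
  elim: s => [|s /= ->]; first by rewrite addr0.
  by rewrite rmorphD hy rmorph_nat mulrS addrA.
have hsp s : iter s h b = (map_poly j p).[y + s%:R].
  elim: s => [|s /= ->]; first by rewrite addr0.
  rewrite -horner_map /= rmorphD hy rmorph_nat mulrS addrA -map_poly_comp.
  by congr (_.[_]); apply: eq_map_poly => d /=; rewrite hB // E; exists d.
have natI : injective (fun s : nat => y + s%:R).
  move=> s t /addrI /eqP; have := (pcharf0P F).1 char0.
  wlog st : s t / (s <= t)%N => [wl cp|cp].
    by have /orP[|] := leq_total s t => /wl H; [apply: H|rewrite eq_sym => /(H cp)].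
  by rewrite eq_sym -subr_eq0 -natrB // cp subn_eq0 => ts; apply/eqP; rewrite eqn_leq st.
have Np i : N (map_poly j p)`_i.
  pose n := size (map_poly j p).
  apply: (@interpolation_ifield _ _ (map (fun s : nat => y + s%:R) (index_iota 0 n)) iN).
  - by rewrite map_inj_uniq // iota_uniq.
  - by rewrite size_map size_iota subn0.
  - move=> _ /mapP[s _ ->]; rewrite -hsp; split; last exact: Nhs.
    by apply: (ifieldD iN) => //; apply: (ifield_nat _ iN).
(* The coefficients are algebraic over [Z] and [y], and lie in [acl (Y \ y)]. If one were not
   algebraic over [Z], exchange would put [y] in [acl (Y \ y)]. The induction hypothesis therefore
   applies to them. *)
have Zp i : adjoin Z (map_poly j p)`_i.
  have [Mpi api] := Np i; apply: IHr => //; split=> //.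
  apply: contrapT => npi; apply: ny.
  have := acl_exchange api npi; apply: acl_min => z [->|Zz]; last by apply: sub_acl; apply: ZY.
  by rewrite E coef_map; exists p`_i.
have bZ : adjoin (y |` Z) b.
  rewrite Ep evalXE; apply: (ifield_horner (adjoin_field _ _)); last by apply: sub_adjoin; left.
  by move=> i; apply: adjoinS (Zp i) => z; right.
have -> : a = b / evalX j0 y c by rewrite /b mulrC mulKf.
exact: (ifield_div (adjoin_field _ _)).
Qed.

Variable N : set G.
Hypothesis N1 : N 1%g.
Hypothesis NM : forall g h, N g -> N h -> N (g * h)%g.
Hypothesis NV : forall g, N g -> N g^-1%g.
Hypothesis NJ : forall u g, Gc u -> N g -> N (u * g * u^-1)%g.

Definition fixed_set Y :=
  [set z | acl Y z /\ forall h : G, N h -> fixing Y h -> h z = z].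

Lemma fixed_ifield Y : ifield (fixed_set Y).
Proof.
have EE z : (z \in fixed_set Y) <-> fixed_set Y z by split=> [/set_mem|/mem_set].
have ia := acl_field iota Y; split; last first.
  by move=> _ [c _ <-]; split; [exact: ifield_iota|move=> h _ _; rewrite autk_fix].
split=> [|z w /EE[az hz] /EE[aw hw]|z w /EE[az hz] /EE[aw hw]]; apply/EE; split.
- exact: ifield1 ia.
- by move=> h _ _; rewrite rmorph1.
- exact: (ifieldB ia).
- by move=> h Nh hY'; rewrite rmorphB hz ?hw.
- exact: (ifield_div ia).
- by move=> h Nh hY'; rewrite fmorph_div hz ?hw.
Qed.

(** In terms of Galois theory, this is what makes the automorphisms of [acl Y] induced by elements
    of [N] fixing [Y] dense in the Galois group over [k(Y)]; see [dense_good]. *)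
Definition good Y := forall a, acl Y a ->
  (forall h, N h -> fixing Y h -> h a = a) -> adjoin Y a.

Lemma autk_adjoin_eq (g h : G) A x : (forall y, A y -> g y = h y) -> adjoin A x -> g x = h x.
Proof.
move=> gh; have : fixing (adjoin A) (h^-1 * g)%g.
  by rewrite fixing_adjoin => y Ay; rewrite autkME gh // autkK.
by move=> fx Ax; have := fx x Ax; rewrite autkME => {2}<-; rewrite autkVK.
Qed.

(** Artin's argument. Let [th] be a primitive element for [S], and [O] its orbit under the elements
    of [N] fixing [Y]. The polynomial with roots [O] has coefficients fixed by these elements, hence
    in [k(Y)], so [s] permutes [O]. *)
Lemma dense_good Y (s : G) S : good Y -> fixing Y s -> finite_set S -> S `<=` acl Y ->
  exists h, [/\ N h, fixing Y h & forall x, S x -> h x = s x].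
Proof.
move=> gY sY fS SY; have [th [ath Sth]] := primitive_element char0 fS SY.
suff [h [Nh hY hth]] : exists h : G, [/\ N h, fixing Y h & h th = s th].
  exists h; split=> // x /Sth; apply: autk_adjoin_eq => y [->//|Yy].
  by rewrite hY ?sY.
have [p [p0 pY pth]] := ath; have iY := adjoin_field iota Y.
have [r Er] := closed_field_poly_normal p.
have rP z : (z \in r) = root p z by rewrite [in RHS]Er rootZ ?lead_coef_eq0 ?root_prod_XsubC.
pose orb z := `[< exists h : G, [/\ N h, fixing Y h & h th = z] >].
pose O := [seq z <- undup r | orb z].
have fixp (h : G) : fixing Y h -> map_poly h p = p.
  rewrite -(fixing_adjoin iota) => hY; apply/polyP => i.
  by rewrite coef_map /= hY.
have OP z : reflect (exists h : G, [/\ N h, fixing Y h & h th = z]) (z \in O).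
  apply: (iffP idP); first by rewrite mem_filter => /andP[/asboolP].
  move=> [h [Nh hY hz]]; rewrite mem_filter mem_undup rP; apply/andP; split.
    by apply/asboolP; exists h.
  by rewrite -hz -(fixp h hY) fmorph_root.
have uO : uniq O by rewrite filter_uniq ?undup_uniq.
pose P := \prod_(z <- O) ('X - z%:P).
have Pfix (h : G) : N h -> fixing Y h -> map_poly h P = P.
  move=> Nh hY; apply: prod_XsubC_stable => // z /OP[g [Ng gfix <-]]; apply/OP.
  by exists (h * g)%g; split=> //; [exact: NM|exact: fixingM].
have PY i : adjoin Y P`_i.
  apply: gY => [|h Nh hY]; last by rewrite -{2}(Pfix h Nh hY) coef_map.
  have [M [m EM]] := ifield_type (acl_field iota Y).
  have [|q Eq] := @prod_XsubC_range _ _ m O; last by rewrite /P Eq EM coef_map; exists q`_i.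
  move=> z; rewrite mem_filter mem_undup rP => /andP[_ pz].
  by rewrite -EM; exists p.
have PX z : root P z = (z \in O) by apply: root_prod_XsubC.
have sP : map_poly s P = P.
  apply/polyP => i; rewrite coef_map /=; move: sY; rewrite -(fixing_adjoin iota); exact.
have /OP[h [Nh hY hth]] : s th \in O.
  rewrite -PX -sP fmorph_root PX; apply/OP; exists 1%g; split=> //; exact: fixing1.
by exists h.
Qed.

(** The fixed field [E] is not known to be finite over [k(Y)], so [stable_purity] is applied to a
    finite part [M] of it that contains [a]. Having the translations in [N] is what makes [M] stable
    under them. *)
Lemma good_from_translations Y : finite_set Y -> independent Y ->
    (forall y, Y y -> exists h : G, [/\ N h, fixing (acl (Y `\ y)) h & h y = y + 1]) ->
  good Y.
Proof.
move=> fY iY hY a aa afix; have [p [p0 pY pa]] := aa.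
pose R := [set z | exists u : G, [/\ Gc u, fixing Y u & u a = z]].
pose E := fixed_set Y.
have iE : ifield E := fixed_ifield Y.
have RE : R `<=` E.
  move=> _ [u [Gu uY <-]]; split.
    by apply: autk_acl aa => y Yy; rewrite uY //; apply: sub_acl.
  move=> h Nh hY'; have : (u^-1 * h * u)%g a = a.
    apply: afix; first by have := NJ (GcircV Gu) Nh; rewrite invgK.
    apply: fixingM => //; apply: fixingM => //; exact: fixingV.
  by rewrite !autkME => /(congr1 u); rewrite autkVK.
have YE : Y `<=` E by move=> y Yy; split; [exact: sub_acl|move=> h _ ->].
have fR : finite_set R.
  have [r Er] := closed_field_poly_normal p.
  apply: (@sub_finite_set _ _ [set` r]) => [_ [u [_ uY <-]]|]; last exact: finite_seq.
  have : root p (u a).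
    rewrite -(_ : map_poly u p = p) ?fmorph_root //.
    by apply/polyP => i; rewrite coef_map /=; move: uY; rewrite -(fixing_adjoin iota); exact.
  by rewrite [in X in X -> _]Er rootZ ?lead_coef_eq0 ?root_prod_XsubC.
pose M := adjoin (Y `|` R); have iM : ifield M := adjoin_field iota _.
have ME : M `<=` E by apply: adjoin_min => // z [/YE|/RE].
have YM : adjoin Y `<=` M by apply: adjoinS => z; left.
have [th [ath Rth]] := primitive_element char0 fR (subset_trans RE (fun z Ez => Ez.1)).
have Mth : M `<=` adjoin (th |` Y).
  apply: adjoin_min; first exact: adjoin_field.
  by move=> z [Yz|/Rth//]; apply: sub_adjoin; right.
have MY : M `<=` acl Y by move=> z /ME[].
have adjh (h : G) y : Y y -> fixing (acl (Y `\ y)) h -> h y = y + 1 ->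
    forall x, Y x -> adjoin Y (h x).
  move=> Yy hB hy x Yx; have [->|xy] := eqVneq x y.
    rewrite hy; apply: (ifieldD (adjoin_field _ _)); first exact: sub_adjoin.
    exact: ifield1 (adjoin_field _ _).
  by rewrite hB; [apply: sub_adjoin|apply: sub_acl; split=> //; exact/eqP].
have /finite_seqP[r EY] := fY.
suff : M `&` acl Y `<=` adjoin Y.
  by apply; split=> //; apply: sub_adjoin; right; exists 1%g; split=> //; exact: Gcirc1.
rewrite [X in acl X]EY [X in _ `<=` adjoin X]EY.
apply: (stable_purity iY iM YM ath Mth); last by rewrite EY.
move=> y Yy; have [h [Nh hB hy]] := hY y Yy; exists h; split=> // b Mb.
apply: contrapT => nMb.
have ahb : algebraic_over M (h b).
  apply: (algebraic_over_sub YM); apply: autk_acl (MY _ Mb) => x Yx.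
  by apply: adjoin_sub_acl; apply: adjh hB hy _ Yx.
have [u [Gu uM] uhb] := exists_Gcirc_moving char0 iM ahb nMb.
(* If [h b] were outside [M], some [u] fixing [M] would move it. But [w] lies in [N] and fixes [Y],
   because [h] preserves [k(Y)], hence fixes [b]; as [u] fixes [b], this says that [u] fixes
   [h b]. *)
apply: uhb; pose w := (h^-1 * (u * h * u^-1))%g.
have Nw : N w by apply: NM; [exact: NV|exact: NJ].
have uV x : M x -> (u^-1%g : G) x = x by apply: fixingV.
have wY : fixing Y w.
  move=> x Yx; rewrite /w !autkME uV; last by apply: YM; apply: sub_adjoin.
  rewrite uM ?autkK //; apply: YM; exact: adjh hB hy _ Yx.
have [_ /(_ w Nw wY)] := ME _ Mb.
by rewrite /w !autkME (uV b Mb) => /(congr1 h); rewrite autkVK.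
Qed.

(** An element of [Gcirc] fixing [Y] and [Y1] agrees on any given [z] of the fixed field [E], and on
    [Y], with an element of [N], so it fixes [z]: by descent [E] is contained in [k(Y, Y1)] and is
    finite over [k(Y)]. Translations in [Gcirc] preserve [E], since they preserve [k(Y)] and
    normalize [N]. *)
Lemma good_transfer Y1 Y : finite_set Y1 -> good Y1 -> finite_set Y -> independent Y ->
  Y `<=` acl Y1 -> Y1 `<=` acl Y -> forall Z, Z `<=` Y -> good Z.
Proof.
move=> fY1 gY1 fY iY YY1 Y1Y Z ZY a aa afix.
pose E := fixed_set Y.
have iE : ifield E := fixed_ifield Y.
have YE : adjoin Y `<=` E.
  by apply: adjoin_min => // y Yy; split; [exact: sub_acl|move=> h _ ->].
have EY1 : E `<=` adjoin (Y `|` Y1).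
  move=> z [az hz]; apply: contrapT => nz.
  have iK := adjoin_field iota (Y `|` Y1).
  have azK : algebraic_over (adjoin (Y `|` Y1)) z.
    by apply: algebraic_over_sub az; apply: adjoinS => w; left.
  have [u [Gu uK] uz] := exists_Gcirc_moving char0 iK azK nz.
  move: uK; rewrite fixing_adjoin => uK.
  have [|||h [Nh hY1 hu]] := @dense_good Y1 u (z |` Y) gY1.
  - by move=> x Y1x; apply: uK; right.
  - by rewrite finite_setU.
  - by move=> x [->|/YY1//]; apply: acl_min az.
  apply: uz; rewrite -hu; last by left.
  by apply: hz => // x Yx; rewrite hu ?uK //; [left|right].
have [th [ath Y1th]] := primitive_element char0 fY1 Y1Y.
have Eth : E `<=` adjoin (th |` Y).
  apply: (subset_trans EY1); apply: adjoin_min; first exact: adjoin_field.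
  by move=> z [Yz|/Y1th//]; apply: sub_adjoin; right.
have /finite_seqP[r EZ] : finite_set Z by apply: sub_finite_set fY.
suff : E `&` acl Z `<=` adjoin Z.
  apply; split=> //; split; first exact: acl_sub aa.
  by move=> h Nh hY; apply: afix => // x /ZY; apply: hY.
rewrite EZ; apply: (stable_purity iY iE YE ath Eth); last by rewrite -EZ.
move=> y Yy; have ny := iY y Yy.
have [v [Gv vB] vy] := exists_translation char0 ny (ifield1 (acl_field iota (Y `\ y))).
have vY x : Y x -> adjoin Y (v x).
  move=> Yx; have [->|xy] := eqVneq x y.
    rewrite vy; apply: (ifieldD (adjoin_field _ _)); first exact: sub_adjoin.
    exact: ifield1 (adjoin_field _ _).
  by rewrite vB; [apply: sub_adjoin|apply: sub_acl; split=> //; exact/eqP].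
exists v; split=> // b [ab hb]; split.
  by apply: autk_acl ab => x /vY; apply: adjoin_sub_acl.
move=> h Nh hY; have : (v^-1 * h * v)%g b = b.
  apply: hb; first by have := NJ (GcircV Gv) Nh; rewrite invgK.
  move=> x Yx; rewrite !autkME; have : h (v x) = v x.
    by move: hY; rewrite -(fixing_adjoin iota); apply; apply: vY.
  by move=> ->; rewrite autkK.
by rewrite !autkME => /(congr1 v); rewrite autkVK.
Qed.

End NormalSubgroups.

(** * Density of normal subgroups *)

Section Approximation.
Variables (k F : closedFieldType) (iota : {rmorphism k -> F}).
Hypothesis char0 : [pchar F] =i pred0.
Implicit Types (A B K Y S : set F) (x y : F).
Local Notation ifield := (intermediate_field iota).
Local Notation adjoin := (adjoin iota).
Local Notation acl := (algebraic_closure iota).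
Local Notation G := (autk iota).
Local Notation Gc := (Gcirc G).
Local Notation independent := (acl_independent iota).
Variable N : set G.
Hypothesis N1 : N 1%g.
Hypothesis NM : forall g h, N g -> N h -> N (g * h)%g.
Hypothesis NV : forall g, N g -> N g^-1%g.
Hypothesis NJ : forall u g, Gc u -> N g -> N (u * g * u^-1)%g.
Hypothesis Nontrivial : exists2 g, N g & g <> 1%g.

Lemma fixing_acl_id (w : G) A : fixing A w -> forall x, acl A x -> acl A (w x).
Proof. by move=> wA; apply: autk_acl => x Ax; rewrite wA //; apply: sub_acl. Qed.

Lemma unity_root_const m x : (0 < m)%N -> x ^+ m = 1 -> range iota x.
Proof.
move=> m0 xm; rewrite -acl0; apply: algebraic_over_acl.
have i0 := acl_field iota set0.
exists ('X^m - 1); split; last by rewrite rootE !hornerE xm subrr.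
  by rewrite -size_poly_gt0 -polyC1 size_XnsubC.
move=> i; rewrite -polyC1 coefB coefXn coefC; apply: (ifieldB i0); first exact: (ifield_nat _ i0).
by case: ifP => _; [exact: (ifield1 i0)|exact: (ifield0 i0)].
Qed.

(* If [f = (t - c) / g^-1 (t - c)] has no [m]-th root in [L = k(Z, g^-1 Z)] and
   [z ^ m = t - c], some [u] in [Aut(F/L)] moves [z / g^-1 z], and [g u g^-1 u^-1]
   fixes [Z] and multiplies [z] by a nontrivial root of unity. *)
Lemma exists_homothety Z t (g : G) : N g -> (g^-1%g : G) t <> t -> finite_set Z -> Z t ->
  exists z (w : G) xi m c, [/\ N w, fixing Z w, w z = iota xi * z, xi != 1 &
    z ^+ m.+1 = t - iota c].
Proof.
move=> Ng gt fZ Zt; set t' := (g^-1%g : G) t in gt.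
have nt : ~ range iota t.
  by move=> [a _ ta]; apply: gt; rewrite /t' -ta autk_fix.
have gt' : g t' = t by rewrite /t' autkVK.
have nt' : ~ range iota t'.
  by move=> [a _ ta]; apply: nt; exists a => //; rewrite -gt' -ta autk_fix.
have ri := acl_field iota set0; rewrite acl0 in ri.
have tc0 c : t - iota c != 0 by rewrite subr_eq0; apply/eqP => tc; apply: nt; exists c.
have tc'0 c : t' - iota c != 0 by rewrite subr_eq0; apply/eqP => tc; apply: nt'; exists c.
(* One of 0 and 1 is suitable: two constant ratios would give a linear equation for [t'] over [k],
   whence [t'] in [k] or [t = t']. *)
have [c nf] : exists c, ~ range iota ((t - iota c) / (t' - iota c)).
  apply: contrapT => /forallNP H.
  have [a _ Ea] : range iota (t / t').
    by have /contrapT := H 0; rewrite !rmorph0 !subr0.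
  have [b _ Eb] : range iota ((t - 1) / (t' - 1)).
    by have /contrapT := H 1; rewrite !rmorph1.
  have t'0 : t' != 0 by have := tc'0 0; rewrite rmorph0 subr0.
  have t'1 : t' - 1 != 0 by have := tc'0 1; rewrite rmorph1.
  have Et : t = iota a * t' by rewrite Ea divfK.
  have Et1 : t - 1 = iota b * (t' - 1) by rewrite Eb divfK.
  have E : (iota a - iota b) * t' = 1 - iota b.
    by rewrite mulrBl -Et -[t](subrK 1) Et1; ring.
  have [ab|ab] := eqVneq (iota a - iota b) 0.
    move: E; rewrite ab mul0r => /esym/eqP; rewrite subr_eq0 => /eqP b1.
    by apply: gt; rewrite Et; move/eqP: ab; rewrite subr_eq0 => /eqP ->; rewrite -b1 mul1r.
  apply: nt'; exists ((1 - b) / (a - b)) => //.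
  by rewrite fmorph_div !rmorphB rmorph1 -E mulrC mulKf.
pose S := Z `|` ((g^-1%g : G) @` Z).
have fS : finite_set S by rewrite finite_setU; split=> //; apply: finite_image.
have iS := adjoin_field iota S.
have St : adjoin S t by apply: sub_adjoin; left.
have St' : adjoin S t' by apply: sub_adjoin; right; exists t.
pose f := (t - iota c) / (t' - iota c).
have Sf : adjoin S f.
  by apply: (ifield_div iS); apply: (ifieldB iS) => //; apply: (ifield_iota _ iS).
have [m m0 nm] := not_divisible char0 fS Sf nf.
have [z zm] : exists z, z ^+ m = t - iota c.
  have /closed_rootP[z] : size ('X^m - (t - iota c)%:P) != 1%N.
    by rewrite size_XnsubC // eqSS -lt0n.
  by rewrite rootE !hornerE subr_eq0 => /eqP; exists z.
pose y := (g^-1%g : G) z.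
have gy : g y = z by rewrite /y autkVK.
have ym : y ^+ m = t' - iota c by rewrite /y -rmorphXn zm rmorphB /= autk_fix.
have z0 : z != 0 by apply: contraNneq (tc0 c) => z0; rewrite -zm z0 expr0n gtn_eqF.
have y0 : y != 0 by apply: contraNneq (tc'0 c) => y0; rewrite -ym y0 expr0n gtn_eqF.
have nzy : ~ adjoin S (z / y).
  by move=> /nm; apply; rewrite expr_div_n zm ym.
have azy : algebraic_over (adjoin S) (z / y).
  exists ('X^m - f%:P); split.
  - by rewrite -size_poly_gt0 size_XnsubC.
  - move=> i; rewrite coefB coefXn coefC; apply: (ifieldB iS); first exact: (ifield_nat _ iS).
    by case: ifP => // _; exact: (ifield0 iS).
  - by rewrite rootE !hornerE expr_div_n zm ym subrr.
have [u [Gu uS] uzy] := exists_Gcirc_moving char0 iS azy nzy.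
have ratio x : x != 0 -> adjoin S (x ^+ m) -> range iota (u x / x).
  move=> x0 Sx; apply: (@unity_root_const m) => //.
  by rewrite expr_div_n -rmorphXn /= uS // divff // expf_neq0.
have [a _ Ea] : range iota (u z / z).
  by apply: ratio => //; rewrite zm; apply: (ifieldB iS) => //; apply: (ifield_iota _ iS).
have [b _ Eb] : range iota (u y / y).
  by apply: ratio => //; rewrite ym; apply: (ifieldB iS) => //; apply: (ifield_iota _ iS).
have uz : u z = iota a * z by rewrite Ea divfK.
have uy : u y = iota b * y by rewrite Eb divfK.
have a0 : a != 0 by rewrite -(fmorph_eq0 iota) Ea mulf_neq0 ?invr_eq0 ?fmorph_eq0.
have ab : b / a != 1.
  apply/eqP => ba; have Eab : b = a by rewrite -[b](divfK a0) ba mul1r.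
  apply: uzy; rewrite fmorph_div uz uy Eab; field.
  by rewrite y0 fmorph_eq0.
have uVz : (u^-1%g : G) z = iota a^-1 * z.
  by apply: (canLR (autkK u)); rewrite rmorphM /= autk_fix uz mulrA -rmorphM mulVf // rmorph1 mul1r.
exists z, (g * (u * g^-1 * u^-1))%g, (b / a), m.-1, c; split=> //.
- by apply: NM => //; apply: NJ => //; apply: NV.
- move=> x Zx; rewrite !autkME (fixingV uS); last by apply: sub_adjoin; left.
  by rewrite uS ?autkVK //; apply: sub_adjoin; right; exists x.
- by rewrite !autkME uVz !rmorphM /= !autk_fix -/y uy rmorphM /= gy autk_fix; ring.
- by rewrite prednK.
Qed.

(** In a basis [Z] containing an element [t] moved by the inverse of [g], [t] is replaced by the
    radical [z], and [acl] does not shrink since [t] is a polynomial in [z]. The translation of [z]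
    is a commutator; those of the other elements are conjugates of it in [Gcirc]. *)
Lemma exists_good S : finite_set S ->
  exists Y, [/\ finite_set Y, independent Y, S `<=` acl Y & good N Y].
Proof.
move=> fS; have [g Ng g1] := Nontrivial.
have [t gt] : exists t, (g^-1%g : G) t <> t.
  apply: contrapT => /forallNP H; apply: g1; apply: autkP => x.
  by have /contrapT e := H x; rewrite -{1}e autkVK.
have nt : ~ range iota t by move=> [a _ ta]; apply: gt; rewrite -ta autk_fix.
have it : independent [set t] by move=> y ->; rewrite setDv acl0.
have [Z [fZ iZ tZ _ SZ]] := exists_basis (finite_set1 t) it fS.
have Zt : Z t by apply: tZ.
have [z [w [xi [m [c [Nw wZ wz xi1 zm]]]]]] := exists_homothety Ng gt fZ Zt.
pose A := Z `\ t; have nA : ~ acl A t := iZ t Zt.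
have iA := acl_field iota A.
have nz : ~ acl A z.
  move=> az; apply: nA; rewrite -(subrK (iota c) t) -zm.
  by apply: (ifieldD iA); [apply: (ifieldX _ iA)|apply: (ifield_iota _ iA)].
have AZ : A `<=` Z by move=> x [].
have wA : fixing A w by move=> x /AZ; apply: wZ.
(* The commutator of the translation by [b] with the homothety of ratio [xi] translates [z] by
   [b * (1 - xi^-1)], which has to be 1. *)
pose b := (1 - xi^-1)^-1.
have xi0 : xi != 0.
  apply/eqP => xi0; apply: nz; move: wz; rewrite xi0 rmorph0 mul0r => /eqP.
  by rewrite fmorph_eq0 => /eqP->; apply: ifield0 iA.
have b0 : 1 - xi^-1 != 0 by rewrite subr_eq0 eq_sym invr_eq1.
have [v [Gv vA] vz] := exists_translation char0 nz (ifield_iota b iA).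
have wVz : (w^-1%g : G) z = iota xi^-1 * z.
  by apply: (canLR (autkK w)); rewrite rmorphM /= autk_fix wz mulrA -rmorphM mulVf // rmorph1 mul1r.
have vVz : (v^-1%g : G) z = z - iota b.
  by apply: (canLR (autkK v)); rewrite rmorphB vz autk_fix addrK.
pose h := (v * w * v^-1 * w^-1)%g.
have Nh : N h by apply: NM; [exact: NJ|exact: NV].
have hA : fixing (acl A) h.
  move=> x ax; rewrite /h !autkME (fixingV vA); last exact: fixing_acl_id (fixingV wA) _ ax.
  by rewrite autkVK vA.
have hz : h z = z + 1.
  rewrite /h !autkME wVz !rmorphM /= !autk_fix vVz !rmorphB /= wz !rmorphM /= vz !autk_fix.
  rewrite mulrBr mulrA -rmorphM mulVf // rmorph1 mul1r -addrA; congr (_ + _).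
  by rewrite -[X in X - _]mul1r -mulrBl -(rmorph1 iota) -rmorphB -rmorphM mulfV ?rmorph1.
clearbody h; have zA : ~ A z by move/sub_acl.
pose Y := z |` A; have YDz : Y `\ z = A.
  apply/seteqP; split=> [x [[->|//] xz]|x Ax]; first by case: xz.
  by split; [right|move=> xz; apply: zA; rewrite -xz].
have fA : finite_set A by apply: sub_finite_set fZ.
have fY : finite_set Y by rewrite finite_setU.
have iY : independent Y by apply: independentU1 => //; apply: independent_sub iZ.
exists Y; split=> //.
  move=> x /SZ; apply: acl_min => y Zy; have [->|yt] := eqVneq y t; last first.
    by apply: sub_acl; right; split=> //; exact/eqP.
  have iaY := acl_field iota Y; rewrite -(subrK (iota c) t) -zm.
  apply: (ifieldD iaY); last exact: (ifield_iota _ iaY).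
  by apply: (ifieldX _ iaY); apply: sub_acl; left.
apply: good_from_translations => // y [->|Ay]; first by exists h; rewrite YDz.
have yz : y != z by apply/eqP => yz; apply: zA; rewrite -yz.
have Yy : Y y by right.
pose B := Y `\ y; have ny : ~ acl B y := iY y Yy.
have Bz : acl B z by apply: sub_acl; split; [left|move=> zy; move/eqP: yz; rewrite zy].
have [e1 [Ge1 e1A] e1z] := exists_translation char0 nz (sub_acl iota Ay).
have [e2 [Ge2 e2B] e2y] := exists_translation char0 ny (ifieldN (acl_field iota B) Bz).
have e1y : e1 y = y by apply: e1A; apply: sub_acl.
have e2z : e2 z = z by apply: e2B.
(* The factorization of the Weyl element of SL_2 into three elementary matrices: [s] sends [z] to
   [y] and [y] to [- z]. *)
pose s := (e1 * e2 * e1)%g.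
have sz : s z = y by rewrite /s !autkME e1z rmorphD e2z e2y rmorphD rmorphB /= e1z e1y; ring.
have sy : s y = - z by rewrite /s !autkME e1y e2y rmorphB /= e1z e1y; ring.
have sx x : A x -> x <> y -> s x = x.
  move=> Ax xy; have e1x : e1 x = x by apply: e1A; apply: sub_acl.
  by rewrite /s !autkME e1x (e2B x) //; apply: sub_acl; split; [right|].
have Gs : Gc s by apply: GcircM => //; apply: GcircM.
clearbody s; have sVB x : acl B x -> acl A ((s^-1%g : G) x).
  apply: (autk_acl (A := B)) => {x} x [[->|Ax] xy].
    have -> : (s^-1%g : G) z = - y by apply: (canLR (autkK s)); rewrite rmorphN sy opprK.
    by apply: (ifieldN iA); apply: sub_acl.
  by rewrite -{1}(sx _ Ax xy) autkK; apply: sub_acl.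
exists (s * h * s^-1)%g; split.
- exact: NJ.
- by move=> x Bx; rewrite !autkME hA ?autkVK //; apply: sVB.
- by rewrite !autkME -{1}sz autkK hz rmorphD rmorph1 sz.
Qed.

(** The sets prescribing the image of [x] are open and cover [C], so the orbit of [x] is finite. [A]
    consists of the coefficients of the polynomial whose roots are this orbit. *)
Lemma compact_orbit (C : set G) x : subgroup C -> compact C ->
  exists A, [/\ finite_set A, forall g y, C g -> A y -> g y = y & acl A x].
Proof.
move=> gC cC; pose T : ptopologicalType := HB.pack G (isPointed.Build G 1%g).
have : @compact T C := cC.
rewrite compact_cover => /(_ F setT (fun y => [set g : G | g x = y]))[|g Cg|D _ CD].
- move=> y _; rewrite openE => g /= gx; apply: filterS (nbhs_agree g (finite_set1 x)) => h /= ->//.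
- by exists (g x).
pose O := [seq y <- enum_fset D | `[< exists2 g, C g & g x = y >]].
have OP y : reflect (exists2 g, C g & g x = y) (y \in O).
  apply: (iffP idP); first by rewrite mem_filter => /andP[/asboolP].
  move=> [g Cg gx]; rewrite mem_filter; apply/andP; split; first by apply/asboolP; exists g.
  by have [z Dz /= gz] := CD g Cg; rewrite -gx gz.
have uO : uniq O by rewrite filter_uniq ?fset_uniq.
pose P := \prod_(z <- O) ('X - z%:P).
have C1 : C 1%g by case: gC => /set_mem.
have CM g h : C g -> C h -> C (g * h)%g.
  by move=> Cg Ch; apply: set_mem; apply: (group_closedM gC); exact: mem_set.
have Pfix (h : G) : C h -> map_poly h P = P.
  move=> Ch; apply: prod_XsubC_stable => // z /OP[g Cg <-]; apply/OP.
  by exists (h * g)%g => //; apply: CM.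
exists [set` (P : seq F)]; split; first exact: finite_seq.
  move=> g y Cg /= /(nthP 0)[i _ <-].
  by rewrite -{2}(Pfix g Cg) coef_map.
exists P; split.
- by rewrite monic_neq0 // monic_prod_XsubC.
- move=> i; have [iP|iP] := ltnP i (size P); first by apply: sub_adjoin; exact: mem_nth.
  by rewrite nth_default //; apply: ifield0 (adjoin_field _ _).
- by rewrite root_prod_XsubC; apply/OP; exists 1%g.
Qed.

(** A good basis [Y1] need not be fixed by [s]. A basis [Z] of [A] extracted from [A] itself is
    fixed by [s]; it is completed by elements of [Y1] to a basis [Y] with the same closure as [Y1],
    and goodness passes from [Y1] to the subset [Z] of [Y]. *)
Lemma compact_approximation (C : set G) (s : G) S : subgroup C -> compact C -> C s ->
  finite_set S -> exists2 h, N h & forall x, S x -> h x = s x.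
Proof.
move=> gC cC Cs fS.
have [A [fA sA SA]] : exists A, [/\ finite_set A, fixing A s & S `<=` acl A].
  case/finite_seqP: fS => r ->; elim: r => [|x r [A [fA sA rA]]].
    by exists set0; split.
  have [B [fB CB Bx]] := compact_orbit x gC cC.
  exists (A `|` B); split.
  - by rewrite finite_setU.
  - by move=> y [/sA//|By]; apply: CB By.
  move=> y /=; rewrite inE => /predU1P[->|yr].
    by apply: acl_sub Bx => z; right.
  by apply: acl_sub (rA y yr) => z; left.
have [Y1 [fY1 iY1 AY1 gY1]] := exists_good fA.
have i0 : independent set0 by [].
have [Z [fZ iZ _ ZA AZ]] := exists_basis (finite_set0 F) i0 fA.
rewrite set0U in ZA.
have [Y [fY iY ZY YY1 Y1Y]] := exists_basis fZ iZ fY1.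
have gZ : good N Z.
  apply: (good_transfer char0 N1 NM NJ fY1 gY1 fY iY) => //.
  by move=> y /YY1[/ZA/AY1|/sub_acl].
have [||h [Nh _ hS]] := dense_good char0 N1 NM (s := s) gZ _ fS.
- by move=> x /ZA/sA.
- by move=> x /SA; apply: acl_min.
- by exists h.
Qed.

End Approximation.

(** * Closed normal subgroups and kernels *)

Lemma normal_closed_dichotomy (k F : closedFieldType) (iota : {rmorphism k -> F})
    (H N : set (autk iota)) :
    [pchar F]%R =i pred0 -> subgroup H -> Gcirc (autk iota) `<=` H ->
    subgroup N -> N `<=` H -> (forall u g, H u -> N g -> N (u * g * u^-1)%g) ->
    (forall s, H s ->
      (forall B, nbhs (s : subspace H) B -> exists2 h, N h & B h) -> N s) ->
  (forall g, N g -> g = 1%g) \/ Gcirc (autk iota) `<=` N.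
Proof.
move=> char0 gH GH gN NH NJ Ncl.
have [[g Ng g1]|nN] := EM (exists2 g, N g & g <> 1%g); last first.
  by left=> g Ng; apply: contrapT => g1; apply: nN; exists g.
right; apply: smallest_sub => // s [C [gC cC] Cs].
have Gs : Gcirc (autk iota) s by move=> X [_]; apply; exists C.
have N1 : N 1%g by case: gN => /set_mem.
have NM g1' h : N g1' -> N h -> N (g1' * h)%g.
  by move=> Ng' Nh; apply: set_mem; apply: (group_closedM gN); exact: mem_set.
have NV g' : N g' -> N g'^-1%g.
  by move=> Ng'; apply: set_mem; apply: (group_closedV gN); exact: mem_set.
apply: Ncl => [|B sB]; first exact: GH.
have {sB} : within H (nbhs s) B by rewrite nbhs_subspace_in //; apply: GH.
case=> S fS sB.
have [||h Nh hs] := compact_approximation char0 N1 NM NV _ _ gC cC Cs fS.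
- by move=> u g' /GH; apply: NJ.
- by exists g.
exists h => //; apply: sB (NH _ Nh); exists (s^-1 * h)%g; last by rewrite mulgA mulgV mul1g.
by rewrite fixing_adjoin => x Sx; rewrite autkME hs // autkK.
Qed.

(** Both halves apply the dichotomy to the kernel. It is closed in [H] since points of a Hausdorff
    group are closed, and in the linear case since it is the intersection of the stabilizers of all
    vectors. *)
Theorem corollary2p11 (k F : closedFieldType) (iota : {rmorphism k -> F})
    (n : option nat)
    (char0 : [pchar k] =i pred0)
    (n_ge1 : n <> Some 0%N)
    (trdegF : has_trdeg iota n)
    (H : set (autk iota))
    (Hgroup : subgroup H)
    (HGcirc : Gcirc (autk iota) `<=` H) :
  (* continuous homomorphisms to Hausdorff topological groups *)
  (forall (T : topologicalGroupType) (pi : autk iota -> T),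
      hausdorff_space T ->
      {in H &, {morph pi : g h / (g * h)%g}} ->
      {within H, continuous pi} ->
      {in H &, injective pi} \/ (forall g, Gcirc (autk iota) g -> pi g = 1%g))
  /\
  (* continuous linear representations *)
  (forall (E : fieldType) (W : lmodType E) (rho : autk iota -> {linear W -> W}),
      continuous_representation H rho ->
      {in H &, forall g h, rho g =1 rho h -> g = h} \/
      (forall g, Gcirc (autk iota) g -> rho g =1 id)).
Proof.
have char0F : [pchar F] =i pred0 by apply/(pchar0_rmorph iota).
have H1 : H 1%g by case: Hgroup => /set_mem.
have HM g h : H g -> H h -> H (g * h)%g.
  by move=> Hg Hh; apply: set_mem; apply: (group_closedM Hgroup); exact: mem_set.
have HV g : H g -> H g^-1%g.
  by move=> Hg; apply: set_mem; apply: (group_closedV Hgroup); exact: mem_set.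
split=> [T pi T2 piM pic|E W rho [[rho1 rhoM] rhoc]].
  have pM g h : H g -> H h -> pi (g * h)%g = (pi g * pi h)%g.
    by move=> Hg Hh; apply: piM; exact: mem_set.
  have p1 : pi 1%g = 1%g by apply: (mulgI (pi 1%g)); rewrite -pM // !mulg1.
  have pV g : H g -> pi g^-1%g = (pi g)^-1%g.
    by move=> Hg; apply: (mulgI (pi g)); rewrite -pM ?mulgV //; exact: HV.
  pose N := [set g | H g /\ pi g = 1%g].
  have [||||NI|NG] := @normal_closed_dichotomy k F iota H N char0F Hgroup HGcirc.
  - split; first by apply: mem_set.
    move=> g h /set_mem[Hg pg] /set_mem[Hh ph]; apply: mem_set.
    split; first by apply: (HM) => //; exact: HV.
    by rewrite pM ?pV ?pg ?ph ?invg1 ?mulg1 //; exact: HV.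
  - by move=> g [].
  - move=> u g Hu [Hg pg]; split; first by apply: (HM); [exact: HM|exact: HV].
    by rewrite !pM ?pV ?pg ?mulg1 ?mulgV //; [exact: HM|exact: HV].
  - move=> s Hs sN; split=> //; apply: T2 => A B As B1.
    have [h [_ ph] Ah] := sN _ (pic s _ As).
    by exists 1%g; split; [rewrite -ph|exact: nbhs_singleton].
  - left=> g h /set_mem Hg /set_mem Hh pgh.
    have : (g * h^-1)%g = 1%g.
      by apply: NI; split; [apply: (HM) => //; exact: HV|rewrite pM ?pV ?pgh ?mulgV //; exact: HV].
    by move=> /(congr1 (fun x => x * h)%g); rewrite -mulgA mulVg mulg1 mul1g.
  - by right=> g /NG[].
have rM g h w : H g -> H h -> rho (g * h)%g w = rho g (rho h w).
  by move=> Hg Hh; apply: rhoM; exact: mem_set.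
pose N := [set g | H g /\ rho g =1 id].
have [||||NI|NG] := @normal_closed_dichotomy k F iota H N char0F Hgroup HGcirc.
- split; first by apply: mem_set.
  move=> g h /set_mem[Hg rg] /set_mem[Hh rh]; apply: mem_set.
  split; first by apply: (HM) => //; exact: HV.
  move=> w; rewrite rM ?rg //; last exact: HV.
  by rewrite -{1}(rh w) -rM ?mulVg ?rho1 //; exact: HV.
- by move=> g [].
- move=> u g Hu [Hg rg]; split; first by apply: (HM); [exact: HM|exact: HV].
  move=> w; rewrite rM; [|exact: HM|exact: HV].
  by rewrite rM // rg -rM ?mulgV ?rho1 //; exact: HV.
- move=> s Hs sN; split=> // w; suff [] : [set g | H g /\ rho g w = w] s by [].
  apply: rhoc => B sB; have [h [Hh rh] Bh] := sN _ sB.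
  by exists h; split=> //; split=> //; exact: rh.
- left=> g h /set_mem Hg /set_mem Hh rgh.
  have : (g * h^-1)%g = 1%g.
    apply: NI; split; first by apply: (HM) => //; exact: HV.
    by move=> w; rewrite rM ?rgh -?rM ?mulgV ?rho1 //; exact: HV.
  by move=> /(congr1 (fun x => x * h)%g); rewrite -mulgA mulVg mulg1 mul1g.
- by right=> g /NG[].
Qed.
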